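(* Let $P:[0,1]^2\to(0,\infty)$ be continuous with $\int_0^1 P(x,y)\,dy=1$ for all $x$, let $\theta$ be its positive continuous invariant density and $\mu(dx)=\theta(x)\,dx$. Let $\mathbb{P}_\mu$ be the law of the stationary Markov jump process determined by $P$ and $\hat{\mathbb{P}}_\mu$ the law of its time-reversal process, both with initial measure $\mu$. Then the entropy production rate of the time-reversal process is the same as that of the original process: $$ep^{*}:=-H(\hat{\mathbb{P}}_\mu\,|\,\mathbb{P}_\mu)=-H(\mathbb{P}_\mu\,|\,\hat{\mathbb{P}}_\mu)=:ep .$$
   Context: $\mathcal{D}$ is the space of c\`adl\`ag paths $w:[0,\infty)\to[0,1]$, and $\mathcal{F}_T$ is the $\sigma$-algebra generated by the coordinates $w(s)$, $0\le s\le T$. The invariant density $\theta:[0,1]\to(0,\infty)$ is the (unique) continuous probability density with $\int_0^1\theta(y)P(y,x)\,dy=\theta(x)$ for all $x$. $\mathbb{P}_\mu$ is the probability on $\mathcal{D}$ induced by the continuous-time Markov jump process with jump rate identically $1$, jump kernel $P(x,y)\,dy$ and initial law $\mu$; its infinitesimal generator is $(Lf)(x)=\int_0^1[f(y)-f(x)]P(x,y)\,dy$. The time-reversal process is the Markov jump process with jump rate identically $1$ and jump kernel $P^*(x,y)\,dy$, where $P^*(x,y)=\frac{\theta(y)}{\theta(x)}P(y,x)$; its generator is the adjoint of $L$ in $\mathcal{L}^2(\mu)$, and it describes, on each interval $[0,T]$, the stationary process run backwards in time. $\hat{\mathbb{P}}_\mu$ is the probability it induces on $\mathcal{D}$ with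 initial law $\mu$. For two such probabilities $\mathbb{Q},\mathbb{Q}'$ on $\mathcal{D}$, mutually absolutely continuous on each $\mathcal{F}_T$, set $$H_T(\mathbb{Q}\,|\,\mathbb{Q}')=-\int_{\mathcal{D}}\log\left(\left.\frac{d\mathbb{Q}}{d\mathbb{Q}'}\right|_{\mathcal{F}_T}\right)d\mathbb{Q},\qquad H(\mathbb{Q}\,|\,\mathbb{Q}')=\lim_{T\to\infty}\frac1T H_T(\mathbb{Q}\,|\,\mathbb{Q}').$$ The entropy production rate of the original process is $ep=-H(\mathbb{P}_\mu|\hat{\mathbb{P}}_\mu)$, and that of the time-reversal process is $ep^*=-H(\hat{\mathbb{P}}_\mu|\mathbb{P}_\mu)$. *)

(* Defs.v *)
From HB Require Import structures.
From mathcomp Require Import all_boot all_order all_algebra.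
From mathcomp Require Import all_classical all_reals all_analysis.

Set Implicit Arguments.
Unset Strict Implicit.
Unset Printing Implicit Defensive.
Import Order.TTheory GRing.Theory Num.Theory.
Import numFieldNormedType.Exports.
Local Open Scope classical_set_scope.
Local Open Scope ring_scope.
Local Open Scope charge_scope.

Lemma max0_ge0 (R : realType) (t : R) : 0 <= Num.max 0 t.
Proof. by rewrite le_max lexx. Qed.

(* A path on [0, oo) is continued to the whole line by its value at 0, so that
   the one-sided filters of R apply; the left limit at 0 is then no condition. *)
Definition extend_path (R : realType) (w : {nonneg R} -> R) (t : R) : R :=
  w (NngNum (max0_ge0 t)).

Definition cadlag (R : realType) (w : {nonneg R} -> R) : Prop :=
  forall t : R, 0 <= t ->
    extend_path w s @[s --> t^'+] --> extend_path w t /\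
    cvg (extend_path w s @[s --> t^'-]).

Record cadlag_path (R : realType) := CadlagPath {
  path_fun :> {nonneg R} -> R ;
  path_itv : forall t, path_fun t \in `[0, 1] ;
  path_cadlag : cadlag path_fun
}.

Lemma cst0_cadlag (R : realType) : cadlag (fun _ : {nonneg R} => 0 : R).
Proof. by move=> t _; split; [exact: cvg_cst|exact: is_cvg_cst]. Qed.

Lemma cst0_itv (R : realType) (t : {nonneg R}) : (0 : R) \in `[0, 1].
Proof. by rewrite in_itv /= lexx ler01. Qed.

HB.instance Definition _ (R : realType) := gen_eqMixin (cadlag_path R).
HB.instance Definition _ (R : realType) := gen_choiceMixin (cadlag_path R).
HB.instance Definition _ (R : realType) :=
  isPointed.Build (cadlag_path R)
    (CadlagPath (@cst0_itv R) (@cst0_cadlag R)).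

Definition coord_sets (R : realType) (S : set {nonneg R}) :
    set (set (cadlag_path R)) :=
  [set A | exists s, S s /\ exists2 B : set R, measurable B &
           A = [set w : cadlag_path R | B (w s)]].

Definition pathT (R : realType) :=
  g_sigma_algebraType (coord_sets [set: {nonneg R}]).

Definition pathT_upto (R : realType) (T : R) :=
  g_sigma_algebraType (coord_sets [set s : {nonneg R} | s%:num <= T]).

Definition to_upto (R : realType) (T : R) (w : pathT R) : pathT_upto T := w.

Lemma measurable_to_upto (R : realType) (T : R) :
  measurable_fun [set: pathT R] (@to_upto R T).
Proof.
move=> _ A mA; rewrite setTI.
have : <<s coord_sets [set: {nonneg R}] >> A; last by [].
apply: sub_sigma_algebra2 mA => B [s [_ ?]]; by exists s.
Qed.

HB.instance Definition _ (R : realType) (T : R) :=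
  isMeasurableFun.Build _ _ _ _ (@to_upto R T) (@measurable_to_upto R T).

Definition restr_upto (R : realType) (Q : probability (pathT R) R) (T : R) :
    probability (pathT_upto T) R :=
  distribution Q (@to_upto R T).

(* H_T(Q | Q'); with this sign convention it is minus the Kullback-Leibler
   divergence of the restrictions to F_T, the sigma-algebra of pathT_upto T. *)
Definition rel_entropy (R : realType) (Q Q' : probability (pathT R) R) (T : R) :
    \bar R :=
  (- \int[Q]_w
     lne (('d (charge_of_finite_measure (restr_upto Q T)) '/d (restr_upto Q' T))
            (to_upto T w)))%E.

Definition mean_rel_entropy (R : realType) (Q Q' : probability (pathT R) R)
    (T : R) : \bar R := ((T^-1)%:E * rel_entropy Q Q' T)%E.

Definition rel_entropy_rate (R : realType) (Q Q' : probability (pathT R) R) :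
    \bar R := lim (mean_rel_entropy Q Q' T @[T --> +oo]).

Definition mutually_ac (R : realType) (Q Q' : probability (pathT R) R) : Prop :=
  forall T : R, 0 <= T ->
    restr_upto Q T `<< restr_upto Q' T /\ restr_upto Q' T `<< restr_upto Q T.

(* For f = theta this is the measure mu, for f = P x the jump kernel at x. *)
Definition density_law (R : realType) (f : R -> R) (A : set R) : \bar R :=
  (\int[lebesgue_measure]_(y in `[0%R, 1%R] `&` A) (f y)%:E)%E.

(* A time-homogeneous chain with states in [0, 1], initial law mu and kernel K:
   the Markov property is stated on the rectangles, which generate the past. *)
Definition markov_chain (R : realType) (d : measure_display)
    (Omega : measurableType d) (Pr : probability Omega R)
    (mu : set R -> \bar R) (K : R -> set R -> \bar R)
    (Y : nat -> {RV Pr >-> R}) : Prop :=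
  [/\ forall n w, Y n w \in `[0, 1],
      forall A, measurable A -> Pr (Y 0%N @^-1` A) = mu A
    & forall (n : nat) (A : nat -> set R) (B : set R),
        (forall k, measurable (A k)) -> measurable B ->
        Pr ((\bigcap_(k < n.+1) Y k @^-1` A k) `&` Y n.+1 @^-1` B) =
        (\int[Pr]_(w in \bigcap_(k < n.+1) Y k @^-1` A k) K (Y n w) B)%E].

(* The holding times tau_n are exponential of rate 1, mutually independent and
   independent of the chain Y. *)
Definition holding_times (R : realType) (d : measure_display)
    (Omega : measurableType d) (Pr : probability Omega R)
    (Y tau : nat -> {RV Pr >-> R}) : Prop :=
  (forall n B, measurable B -> Pr (tau n @^-1` B) = exponential_prob 1 B) /\
  (forall (n : nat) (A B : nat -> set R),
     (forall k, measurable (A k)) -> (forall k, measurable (B k)) ->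
     Pr (\bigcap_(k < n) (Y k @^-1` A k `&` tau k @^-1` B k)) =
     (Pr (\bigcap_(k < n) Y k @^-1` A k) *
      \prod_(k < n) Pr (tau k @^-1` B k))%E).

(* Q is the law on path space of the jump process with jump rate 1, initial law
   mu and jump kernel K: the process sits at Y n from the n-th jump time
   tau_0 + ... + tau_(n-1) until the next one. Only almost surely do the jump
   times tend to infinity, hence the almost-sure clause. *)
Definition jump_process_law (R : realType) (mu : set R -> \bar R)
    (K : R -> set R -> \bar R) (Q : probability (pathT R) R) : Prop :=
  exists (d : measure_display) (Omega : measurableType d)
         (Pr : probability Omega R) (Y tau : nat -> {RV Pr >-> R})
         (X : {mfun Omega >-> pathT R}),
    [/\ markov_chain mu K Y,
        holding_times Y tau,
        {ae Pr, forall w, forall (n : nat) (t : {nonneg R}),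
           \sum_(k < n) tau k w <= t%:num < \sum_(k < n.+1) tau k w ->
           (X w : cadlag_path R) t = Y n w}
      & forall A, measurable A -> Q A = distribution Pr X A].

Definition reversed_density (R : realType) (theta : R -> R) (P : R -> R -> R)
    (x y : R) : R := theta y / theta x * P y x.

(* Main.v *)
(* Both path laws are built from the same exponential holding times, so on F_T
   the law of the reversed process has a density with respect to that of the
   process: the product, over the jumps x -> y made before T, of the ratio
   g(x, y) = P*(x, y) / P(x, y). Since g(x, x) = 1, this product is the limit of
   the products of g along the grids k T / n, hence an F_T-measurable function
   of the path. By independence and stationarity, the expected sum of log g over
   the jumps is the expected number T of jumps times the mean of log g under
   theta(x) P*(x, y) dx dy. Finally theta(x) P*(x, y) = theta(y) P(y, x) and
   g(y, x) = 1 / g(x, y), so that exchanging x and y turns this mean for one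
   process into the same mean for the other. *)
Require Import Defs.
From HB Require Import structures.
From mathcomp Require Import all_boot all_order all_algebra.
From mathcomp Require Import all_classical all_reals all_analysis.
From mathcomp Require Import measurable_realfun ring lra.
Set Implicit Arguments.
Unset Strict Implicit.
Unset Printing Implicit Defensive.
Import Order.TTheory GRing.Theory Num.Theory.
Import numFieldNormedType.Exports.
Local Open Scope classical_set_scope.
Local Open Scope ring_scope.

(** * Weighted image measures *)

(** The two laws come with unrelated sample spaces, so nothing can be compared sample by sample:
    every comparison is an equality of integrals of nonnegative functions, obtained from uniqueness
    of finite measures on an intersection-stable generator. The number of jumps before T is random;
    a density for finitely many states and holding times applies on each event of exactly n jumps,
    and these events are summed. The logarithm of the density has no sign, so its mean could a
    priori be undefined. Continuity and positivity on the compact square bound |log g| by a constant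
    M, and log g + M and M give two nonnegative jump sums of finite mean. The entropy is defined by
    an abstract Radon-Nikodym derivative, which equals the explicit density only almost everywhere
    for the reference law; absolute continuity carries this equality to the law under which the
    logarithm is integrated. Everything is proved for a general pair of kernels k and k g and then
    applied twice, the second time with P* as reference kernel and the ratio g(y, x), which leads
    back to P. *)

Section weighted_image.
Local Open Scope ereal_scope.
Context d1 d2 (X : measurableType d1) (Y : measurableType d2) (R : realType).
Variables (mu : {measure set X -> \bar R}) (phi : X -> Y) (w : X -> R).
Hypothesis mphi : measurable_fun setT phi.
Hypothesis mw : measurable_fun setT w.
Hypothesis w0 : forall x, (0 <= w x)%R.

Let measurable_preimage A : measurable A -> measurable (phi @^-1` A).
Proof. by move=> mA; rewrite -[X in measurable X]setTI; exact: mphi. Qed.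

(** The image under [phi] of the measure with density [w]. The measurability and sign proofs are
    arguments of the term, so that its measure structure can be inferred from the term itself. *)
Definition weighted_image of measurable_fun setT phi & measurable_fun setT w &
    (forall x, (0 <= w x)%R) :=
  fun A : set Y => \int[mu]_(x in phi @^-1` A) (w x)%:E.

Local Notation wi := (weighted_image mphi mw w0).

Let wi0 : wi set0 = 0.
Proof. by rewrite /weighted_image preimage_set0 integral_set0. Qed.

Let wi_ge0 A : 0 <= wi A.
Proof. by apply: integral_ge0 => x _; rewrite lee_fin. Qed.

Let wi_sigma_additive : semi_sigma_additive wi.
Proof.
move=> F mF tF mUF; rewrite /weighted_image preimage_bigcup.
rewrite ge0_integral_bigcup//.
- by apply: is_cvg_nneseries => n _ _; exact: wi_ge0.
- by move=> k; exact: measurable_preimage.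
- by apply/measurable_EFinP; exact: measurable_funTS.
- by move=> x _; rewrite lee_fin.
- apply/trivIsetP => /= i j _ _ ij; rewrite -preimage_setI.
  by move/trivIsetP : tF => /(_ _ _ _ _ ij) ->//; rewrite preimage_set0.
Qed.

HB.instance Definition _ := isMeasure.Build _ _ _ wi wi0 wi_ge0 wi_sigma_additive.

Import HBNNSimple.

(** On a level set of a simple function the identity is the definition of the measure; linearity and
    monotone convergence on both sides do the rest. *)
Lemma ge0_integral_weighted_image (f : Y -> \bar R) :
  measurable_fun setT f -> (forall y, 0 <= f y) ->
  \int[wi]_y f y = \int[mu]_x (f (phi x) * (w x)%:E).
Proof.
move=> mf f0; pose h := nnsfun_approx measurableT mf.
have -> : \int[wi]_y f y = lim (\int[wi]_y (EFin \o h n) y @[n --> \oo]).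
  have fE y : f y = lim ((EFin \o h n) y @[n --> \oo]).
    by apply/esym/cvg_lim => //; exact: cvg_nnsfun_approx.
  under eq_integral => x _ do rewrite fE.
  apply: monotone_convergence => //.
  - by move=> n; exact/measurable_EFinP.
  - by move=> n x _ /=; rewrite lee_fin.
  - by move=> x _ a b ab; rewrite lee_fin; exact/lefP/nd_nnsfun_approx.
have -> : \int[mu]_x (f (phi x) * (w x)%:E) =
    lim (\int[mu]_x ((h n (phi x))%:E * (w x)%:E) @[n --> \oo]).
  have fE x : f (phi x) * (w x)%:E =
      lim ((h n (phi x))%:E * (w x)%:E @[n --> \oo]).
    apply/esym/cvg_lim => //; apply: cvgeZr => //.
    exact: cvg_nnsfun_approx.
  under eq_integral => x _ do rewrite fE.
  apply: monotone_convergence => //.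
  - move=> n; apply: emeasurable_funM; last exact/measurable_EFinP.
    by apply/measurable_EFinP; exact: measurableT_comp.
  - by move=> n x _ /=; rewrite mule_ge0 ?lee_fin.
  - move=> x _ a b ab/=; rewrite lee_wpmul2r ?lee_fin//.
    exact/lefP/nd_nnsfun_approx.
suff suf n : \int[wi]_y (EFin \o h n) y = \int[mu]_x ((h n (phi x))%:E * (w x)%:E).
  by under eq_fun do rewrite suf.
have mh y : measurable (h n @^-1` [set y]) by [].
transitivity (\sum_(y \in range (h n)) y%:E * wi (h n @^-1` [set y])).
  transitivity (\int[wi]_x
     (\sum_(y \in range (h n)) (y * \1_(h n @^-1` [set y]) x)%:E)).
    by apply: eq_integral => t tE; rewrite /= fimfunE -fsumEFin.
  rewrite ge0_integral_fsum//.
  - apply: eq_fsbigr => r _.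
    by rewrite integralZl_indic_nnsfun// integral_indic// setIT.
  - by move=> y; apply/measurable_EFinP; exact: measurable_funM.
  - by move=> y x _; exact: nnfun_muleindic_ge0.
transitivity (\int[mu]_x (\sum_(y \in range (h n))
    (y * \1_(h n @^-1` [set y]) (phi x))%:E * (w x)%:E)); last first.
  apply: eq_integral => x _; rewrite -ge0_mule_fsuml => [|y]; last first.
    exact: nnfun_muleindic_ge0.
  by rewrite fsumEFin // -(fimfunE _ (phi x)).
rewrite ge0_integral_fsum//; last 2 first.
- move=> y; apply: emeasurable_funM; last exact/measurable_EFinP.
  apply/measurable_EFinP; apply: measurable_funM => //.
  exact: (measurableT_comp (measurable_indic _)).
- by move=> y x _; rewrite mule_ge0 ?lee_fin// -lee_fin nnfun_muleindic_ge0.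
apply: eq_fsbigr => r /[!inE] -[y _ hyr].
have r0 : (0 <= r)%R by rewrite -hyr.
under [RHS]eq_integral do rewrite EFinM -muleA.
rewrite ge0_integralZl//.
- congr (_ * _); rewrite /weighted_image integral_mkcond.
  apply: eq_integral => x _; rewrite patchE /= indicE.
  have -> : (x \in phi @^-1` (h n @^-1` [set r])) = (phi x \in h n @^-1` [set r]).
    by apply/idP/idP; rewrite !inE.
  by case: ifPn => _; rewrite ?mul1e ?mul0e.
- apply: emeasurable_funM; last exact/measurable_EFinP.
  by apply/measurable_EFinP; exact: (measurableT_comp (measurable_indic _)).
- by move=> x _; rewrite mule_ge0 ?lee_fin.
Qed.

End weighted_image.

(** Two weighted images that agree on an intersection-stable generator containing the whole space,
    one of them finite, are equal by uniqueness of measures. This is how an identity known on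
    rectangles or cylinders is extended to all nonnegative integrands, even across different sample
    spaces. *)
Lemma eq_weighted_integral d1 d2 d3 (X1 : measurableType d1)
    (X2 : measurableType d2) (Y : measurableType d3) (R : realType)
    (mu1 : {measure set X1 -> \bar R}) (mu2 : {measure set X2 -> \bar R})
    (phi1 : X1 -> Y) (phi2 : X2 -> Y) (w1 : X1 -> R) (w2 : X2 -> R)
    (G : set (set Y)) :
  measurable_fun setT phi1 -> measurable_fun setT w1 -> (forall x, 0 <= w1 x) ->
  measurable_fun setT phi2 -> measurable_fun setT w2 -> (forall x, 0 <= w2 x) ->
  measurable = <<s G >> -> setI_closed G -> G setT ->
  (\int[mu1]_x (w1 x)%:E < +oo)%E ->
  (forall A, G A -> \int[mu1]_(x in phi1 @^-1` A) (w1 x)%:E =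
                    \int[mu2]_(x in phi2 @^-1` A) (w2 x)%:E)%E ->
  forall f : Y -> \bar R, measurable_fun setT f -> (forall y, 0 <= f y)%E ->
  (\int[mu1]_x (f (phi1 x) * (w1 x)%:E) = \int[mu2]_x (f (phi2 x) * (w2 x)%:E))%E.
Proof.
move=> mphi1 mw1 w10 mphi2 mw2 w20 mG GI GT w1oo w12 f mf f0.
rewrite -(ge0_integral_weighted_image _ mphi1 mw1 w10)//.
rewrite -(ge0_integral_weighted_image _ mphi2 mw2 w20)//.
apply: eq_measure_integral => A mA _.
apply: (measure_unique G (fun _ => setT)) => //.
by rewrite bigcup_const//.
Qed.

Lemma probability_integral_cst1 d (X : measurableType d) (R : realType)
    (mu : probability X R) A : measurable A ->
  (\int[mu]_(x in A) (cst 1 x : R)%:E = mu A)%E.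
Proof.
by move=> mA; rewrite (eq_integral (cst 1%E))// integral_cst// mul1e.
Qed.

Lemma eq_integral_image d1 d2 d3 (X1 : measurableType d1)
    (X2 : measurableType d2) (Y : measurableType d3) (R : realType)
    (mu1 : probability X1 R) (mu2 : probability X2 R)
    (phi1 : X1 -> Y) (phi2 : X2 -> Y)
    (G : set (set Y)) :
  measurable_fun setT phi1 -> measurable_fun setT phi2 ->
  measurable = <<s G >> -> setI_closed G -> G setT ->
  (forall A, G A -> mu1 (phi1 @^-1` A) = mu2 (phi2 @^-1` A))%E ->
  forall f : Y -> \bar R, measurable_fun setT f -> (forall y, 0 <= f y)%E ->
  (\int[mu1]_x f (phi1 x) = \int[mu2]_x f (phi2 x))%E.
Proof.
move=> m1 m2 mG GI GT w12 f mf f0.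
have mGm A : G A -> measurable A by rewrite mG; exact: sub_sigma_algebra.
have := @eq_weighted_integral _ _ _ _ _ _ _ mu1 mu2 phi1 phi2 (cst 1) (cst 1) G
  m1 (measurable_cst _) (fun=> ler01) m2 (measurable_cst _) (fun=> ler01) mG GI GT.
rewrite probability_integral_cst1// probability_setT ltry => /(_ erefl) h.
under eq_integral do rewrite -[f _]mule1.
under [RHS]eq_integral do rewrite -[f _]mule1.
apply: h => // A /[dup] GA /mGm mA; rewrite !probability_integral_cst1 ?w12//.
- by rewrite -[X in measurable X]setTI; exact: m2.
- by rewrite -[X in measurable X]setTI; exact: m1.
Qed.

(** * Finite-horizon sequence spaces *)

Section sequence_space.
Context {R : realType}.

Definition seq_rect (n : nat) (A : nat -> set R) : set (nat -> R) :=
  \bigcap_(k < n) [set z | A k (z k)].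

Definition seq_rects (n : nat) : set (set (nat -> R)) :=
  [set E | exists2 A : nat -> set R, (forall k, measurable (A k)) &
           E = seq_rect n A].

(* Real sequences with the sigma-algebra of the first n coordinates. *)
Definition seqT (n : nat) := g_sigma_algebraType (seq_rects n).

Lemma seq_rectsI n : setI_closed (seq_rects n).
Proof.
move=> _ _ [A mA ->] [B mB ->]; exists (fun k => A k `&` B k).
  by move=> k; exact: measurableI.
by rewrite /seq_rect -bigcapI.
Qed.

Lemma seq_rectsT n : seq_rects n setT.
Proof.
exists (fun=> setT) => //.
by rewrite /seq_rect; apply/seteqP; split.
Qed.

Lemma measurable_seq_coord n k : (k < n)%N ->
  measurable_fun [set: seqT n] (fun z : seqT n => z k).
Proof.
move=> kn _ B mB; rewrite setTI; apply: sub_sigma_algebra.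
exists (fun j => if j == k then B else setT); first by move=> j; case: ifP.
apply/seteqP; split => [z Bz j /= _|z /(_ k kn)/=]; last by rewrite eqxx.
by case: eqP => // ->.
Qed.

Lemma measurable_to_seqT d (T : measurableType d) n (f : T -> seqT n) :
  (forall k, (k < n)%N -> measurable_fun setT (fun x => f x k)) ->
  measurable_fun setT f.
Proof.
move=> mf; apply: (@measurability _ _ _ (seqT n) _ _ (seq_rects n)) => //.
move=> _ [_ [A mA ->] <-]; rewrite setTI /seq_rect preimage_bigcap.
apply: bigcap_measurableType => k /= kn.
by have := mf k kn measurableT (A k) (mA k); rewrite setTI.
Qed.

(** Sets the coordinate of index n. Those beyond keep their values, which the sigma-algebra of
    [seqT n.+1] does not see. *)
Definition seq_upd (n : nat) (u : seqT n * R) : seqT n.+1 :=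
  fun k => if k == n then u.2 else u.1 k.

Lemma measurable_seq_upd n : measurable_fun setT (@seq_upd n).
Proof.
apply: measurable_to_seqT => k; rewrite ltnS leq_eqVlt => /predU1P[->|kn].
  by rewrite /seq_upd eqxx; exact: measurable_snd.
rewrite /seq_upd ltn_eqF//.
exact: (measurableT_comp (measurable_seq_coord kn)).
Qed.

Definition seq_run (z : nat -> R) : nat -> R := fun n => \sum_(k < n) z k.

End sequence_space.
Arguments seqT : clear implicits.
Arguments seq_rects : clear implicits.

Section process_sequence.
Context d (T : measurableType d) (R : realType) (Pr : probability T R).
Variable Y : nat -> {RV Pr >-> R}.

Definition path_of (w : T) : nat -> R := fun n => Y n w.

Lemma measurable_path_of n : measurable_fun setT (path_of : T -> seqT R n).
Proof. by apply: measurable_to_seqT => k _; exact: measurable_funPT. Qed.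

Lemma preimage_path_of n (A : nat -> set R) :
  path_of @^-1` seq_rect n A = \bigcap_(k < n) (Y k @^-1` A k).
Proof. by []. Qed.

End process_sequence.
Arguments measurable_path_of {d T R Pr} Y n.
Arguments measurable_seq_upd {R} n.
Arguments measurable_seq_coord {R} n k.

(** * The Markov chain *)

Section markov_property.
Context d (T : measurableType d) (R : realType) (Pr : probability T R).
Variables (Y : nat -> {RV Pr >-> R}) (mu : set R -> \bar R).
Variables (K : R -> set R -> \bar R) (k : R -> R -> R).
Hypothesis chainY : markov_chain mu K Y.
Hypothesis KE : forall x B, x \in `[0, 1] -> measurable B ->
  K x B = (\int[lebesgue_measure]_(y in B) (k x y)%:E)%E.
Hypothesis mk : measurable_fun setT (fun u : R * R => k u.1 u.2).
Hypothesis k0 : forall x y, 0 <= k x y.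
Local Open Scope ereal_scope.

Let mkY n : measurable_fun setT (fun u : T * R => k (Y n u.1) u.2).
Proof.
apply: (measurableT_comp mk (_ : measurable_fun setT (fun u => (Y n u.1, u.2)))).
apply: measurable_fun_pair => /=; last exact: measurable_snd.
by apply: measurableT_comp.
Qed.

(** The Markov property is given on rectangles only. Both members are integrals against weighted
    images: of [Pr] by the chain, and of [Pr] times Lebesgue measure, weighted by [k], by the chain
    with a new last state. Agreement on rectangles therefore suffices. *)
Lemma markov_ge0_integral n (f : seqT R n.+2 -> \bar R) :
  measurable_fun setT f -> (forall z, 0 <= f z) ->
  \int[Pr]_w f (path_of Y w) =
  \int[Pr]_w \int[lebesgue_measure]_y
     (f (seq_upd (n := n.+1) (path_of Y w : seqT R n.+1, y)) * (k (Y n w) y)%:E).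
Proof.
move=> mf f0.
pose phi (u : T * R) : seqT R n.+2 :=
  seq_upd (n := n.+1) (path_of Y u.1 : seqT R n.+1, u.2).
have mphi : measurable_fun setT phi.
  apply: (measurableT_comp (measurable_seq_upd n.+1)).
  apply: measurable_fun_pair => /=; last exact: measurable_snd.
  exact: (measurableT_comp (measurable_path_of Y n.+1) measurable_fst).
have -> : \int[Pr]_w f (path_of Y w) =
    \int[Pr]_w (f (path_of Y w) * (cst 1%R w)%:E).
  by apply: eq_integral => w _; rewrite mule1.
transitivity (\int[Pr \x lebesgue_measure]_u
    (f (phi u) * (k (Y n u.1) u.2)%:E)); last first.
  rewrite fubini_tonelli1//.
    apply: emeasurable_funM; last by move: (mkY n) => /measurable_EFinP.
    exact: measurableT_comp.
  by move=> u; rewrite mule_ge0 ?lee_fin.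
apply: (@eq_weighted_integral _ _ _ _ _ (seqT R n.+2) _ _ _ _ _ _ _
    (seq_rects R n.+2)) => //.
  + exact: measurable_path_of.
  + exact: mkY.
  + exact: seq_rectsI.
  + exact: seq_rectsT.
  + by rewrite probability_integral_cst1// probability_setT ltry.
  + move=> _ [A mA ->].
    rewrite probability_integral_cst1; last first.
      rewrite preimage_path_of; apply: bigcap_measurableType => i _.
      by rewrite -[X in measurable X]setTI; exact: measurable_funPT.
    set E := \bigcap_(i < n.+1) Y i @^-1` A i.
    have mE : measurable E.
      apply: bigcap_measurableType => i _.
      by rewrite -[X in measurable X]setTI; exact: measurable_funPT.
    have preE : path_of Y @^-1` seq_rect n.+2 A = E `&` Y n.+1 @^-1` A n.+1.
      rewrite preimage_path_of /E; apply/seteqP; split => [w Aw|w [Ew An] i /=].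
        split; last by apply: Aw => /=.
        by move=> i /= ni; apply: Aw => /=; rewrite ltnS ltnW.
      by rewrite ltnS leq_eqVlt => /predU1P[->//|ni]; exact: Ew.
    have phiE : phi @^-1` seq_rect n.+2 A = E `*` A n.+1.
      apply/seteqP; split => [[w y] /= Aw|[w y] /= [Ew Ay] i /=].
        split.
          move=> i /= ni; have := Aw i; rewrite /= ltnS ltnW// => /(_ isT).
          by rewrite /phi /seq_upd /= ltn_eqF.
        by have := Aw n.+1; rewrite /= ltnSn /phi /seq_upd/= eqxx; exact.
      rewrite /phi /seq_upd /= ltnS leq_eqVlt => /predU1P[->|ni].
        by rewrite eqxx.
      by rewrite ltn_eqF//; exact: Ew.
    have [Y01 _ HM] := chainY.
    rewrite preE (HM n A (A n.+1))// phiE.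
    rewrite [RHS]integral_mkcond fubini_tonelli1/=.
    * rewrite [LHS]integral_mkcond; apply: eq_integral => w _.
      rewrite /fubini_F patchE; case: ifPn => wE.
        rewrite KE// [LHS]integral_mkcond; apply: eq_integral => y _.
        rewrite !patchE; congr (if _ then _ else _).
        by apply/idP/idP; rewrite !inE /=; [move: wE; rewrite inE; split|case].
      rewrite integral0_eq// => y _; rewrite patchE ifF//.
      apply/negP; rewrite inE => -[/= Ew _].
      by move: wE; rewrite notin_setE; exact.
    * apply/(measurable_restrict _ _ _); rewrite ?setIT//; first by apply: measurableX => //; exact: mA.
      by apply: measurable_funTS; move: (mkY n) => /measurable_EFinP.
    * by move=> u; rewrite patchE; case: ifPn => // _; rewrite lee_fin.
Qed.

End markov_property.

Section path_ratio.
Context {R : realType}.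
Variable g : R -> R -> R.

Definition path_ratio (n : nat) (z : nat -> R) : R :=
  \prod_(i < n) g (z i) (z i.+1).

Lemma path_ratioS n z :
  path_ratio n.+1 z = path_ratio n z * g (z n) (z n.+1).
Proof. by rewrite /path_ratio big_ord_recr. Qed.

Hypothesis mg : measurable_fun setT (fun u : R * R => g u.1 u.2).
Hypothesis g0 : forall x y, 0 <= g x y.

Lemma path_ratio_ge0 n z : 0 <= path_ratio n z.
Proof. by apply: prodr_ge0 => i _. Qed.

Lemma measurable_seq_pair n i : (i.+1 < n)%N ->
  measurable_fun setT (fun z : seqT R n => g (z i) (z i.+1)).
Proof.
move=> ni; apply: (measurableT_comp mg (measurable_fun_pair _ _)).
  by apply: measurable_seq_coord; exact: ltnW.
exact: measurable_seq_coord.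
Qed.

Lemma measurable_path_ratio n m : (n < m)%N ->
  measurable_fun setT (path_ratio n : seqT R m -> R).
Proof.
move=> nm; apply: measurable_prod => i _; apply: measurable_seq_pair.
exact: leq_ltn_trans nm.
Qed.

End path_ratio.

Section chain_density.
Context d1 d2 (T1 : measurableType d1) (T2 : measurableType d2) (R : realType).
Variables (Pr1 : probability T1 R) (Pr2 : probability T2 R).
Variables (Y1 : nat -> {RV Pr1 >-> R}) (Y2 : nat -> {RV Pr2 >-> R}).
Variables (mu : set R -> \bar R) (K1 K2 : R -> set R -> \bar R).
Variables (k g : R -> R -> R).
Hypothesis chainY1 : markov_chain mu K1 Y1.
Hypothesis chainY2 : markov_chain mu K2 Y2.
Hypothesis K1E : forall x B, x \in `[0, 1] -> measurable B ->
  K1 x B = (\int[lebesgue_measure]_(y in B) (k x y)%:E)%E.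
Hypothesis K2E : forall x B, x \in `[0, 1] -> measurable B ->
  K2 x B = (\int[lebesgue_measure]_(y in B) (k x y * g x y)%:E)%E.
Hypothesis mk : measurable_fun setT (fun u : R * R => k u.1 u.2).
Hypothesis k0 : forall x y, 0 <= k x y.
Hypothesis mg : measurable_fun setT (fun u : R * R => g u.1 u.2).
Hypothesis g0 : forall x y, 0 <= g x y.
Local Open Scope ereal_scope.

(** Induction on the horizon: the Markov property of [Y2] integrates out the last state, the
    induction hypothesis moves the remaining integral to [Y1], and the Markov property of [Y1]
    restores the last state. The factor g left over from the kernel of [Y2] extends the product by
    one term. *)
Lemma chain_density n (f : seqT R n.+1 -> \bar R) :
  measurable_fun setT f -> (forall z, 0 <= f z) ->
  \int[Pr2]_w f (path_of Y2 w) =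
  \int[Pr1]_w (f (path_of Y1 w) * (path_ratio g n (path_of Y1 w))%:E).
Proof.
elim: n f => [f mf f0|n IH f mf f0].
  under [RHS]eq_integral do rewrite /path_ratio big_ord0 mule1.
  apply: (@eq_integral_image _ _ _ _ _ (seqT R 1) _ _ _ _ _ (seq_rects R 1)) => //.
  - exact: measurable_path_of.
  - exact: measurable_path_of.
  - exact: seq_rectsI.
  - exact: seq_rectsT.
  - move=> _ [A mA ->].
    have [[_ HY1 _] [_ HY2 _]] := (chainY1, chainY2).
    rewrite !preimage_path_of.
    have E d (T : measurableType d) (Pr : probability T R)
        (Y : nat -> {RV Pr >-> R}) :
        \bigcap_(k < 1) Y k @^-1` A k = Y 0%N @^-1` A 0%N.
      by apply/seteqP; split => [w Aw|w Aw [|]//]; exact: Aw.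
    by rewrite !E; rewrite HY1// HY2.
pose k2 x y := (k x y * g x y)%R.
have mk2 : measurable_fun setT (fun u : R * R => k2 u.1 u.2).
  exact: measurable_funM.
have k20 x y : (0 <= k2 x y)%R by rewrite mulr_ge0.
rewrite (markov_ge0_integral chainY2 K2E mk2 k20)//.
pose H (u : seqT R n.+1 * R) := f (seq_upd u) * (k2 (u.1 n) u.2)%:E.
have H0 u : 0 <= H u by rewrite mule_ge0 ?lee_fin.
have mH : measurable_fun setT H.
  apply: emeasurable_funM.
    exact: (measurableT_comp mf (measurable_seq_upd _)).
  apply/measurable_EFinP; apply: (measurableT_comp mk2 (measurable_fun_pair _ _)).
    exact: (measurableT_comp (measurable_seq_coord n.+1 n (ltnSn _)) measurable_fst).
  exact: measurable_snd.
pose F (z : seqT R n.+1) := \int[lebesgue_measure]_y H (z, y).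
have mF : measurable_fun setT F by exact: measurable_fun_fubini_tonelli_F.
have F0 z : 0 <= F z by exact: integral_ge0.
rewrite (IH F mF F0).
(* The Markov property now acts on the right member, with the ratio over n.+1 steps included in the
   integrand. *)
rewrite (markov_ge0_integral chainY1 K1E mk k0
  (f := fun z => f z * (path_ratio g n.+1 z)%:E))//; last 2 first.
- apply: emeasurable_funM => //.
  by apply/measurable_EFinP; exact: measurable_path_ratio.
- by move=> z; rewrite mule_ge0// lee_fin path_ratio_ge0.
apply: eq_integral => w _; rewrite /F -ge0_integralZr//.
- apply: eq_integral => y _; rewrite /H /= -!muleA -!EFinM; congr (_ * _%:E).
  rewrite path_ratioS /k2 {2 3}/seq_upd /= ltn_eqF// eqxx.
  have -> : path_ratio g n (seq_upd (n := n.+1) (path_of Y1 w, y)) =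
            path_ratio g n (path_of Y1 w).
    apply: eq_bigr => i _.
    by rewrite /seq_upd /= !ltn_eqF// ltnS// ltnW.
  rewrite {1 2}/path_of; ring.
- exact: (measurableT_comp mH (pair1_measurable _)).
- by rewrite lee_fin path_ratio_ge0.
Qed.

End chain_density.

Section stationarity.
Context d (T : measurableType d) (R : realType) (Pr : probability T R).
Variables (Y : nat -> {RV Pr >-> R}) (mu : set R -> \bar R).
Variables (K : R -> set R -> \bar R) (k : R -> R -> R) (theta : R -> R).
Hypothesis chainY : markov_chain mu K Y.
Hypothesis KE : forall x B, x \in `[0, 1] -> measurable B ->
  K x B = (\int[lebesgue_measure]_(y in B) (k x y)%:E)%E.
Hypothesis mk : measurable_fun setT (fun u : R * R => k u.1 u.2).
Hypothesis k0 : forall x y, 0 <= k x y.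
Hypothesis muE : forall B, measurable B ->
  mu B = (\int[lebesgue_measure]_(y in B) (theta y)%:E)%E.
Hypothesis mtheta : measurable_fun setT theta.
Hypothesis theta0 : forall x, 0 <= theta x.
Local Open Scope ereal_scope.
Hypothesis invariant : forall y,
  \int[lebesgue_measure]_x (theta x * k x y)%:E = (theta y)%:E.

Let markov_step n (h : R -> R -> \bar R) :
  measurable_fun setT (fun u : R * R => h u.1 u.2) -> (forall x y, 0 <= h x y) ->
  \int[Pr]_w h (Y n w) (Y n.+1 w) =
  \int[Pr]_w \int[lebesgue_measure]_y (h (Y n w) y * (k (Y n w) y)%:E).
Proof.
move=> mh h0.
rewrite (markov_ge0_integral chainY KE mk k0
  (f := fun z : seqT R n.+2 => h (z n) (z n.+1)))//.
  apply: eq_integral => w _; apply: eq_integral => y _.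
  by rewrite /seq_upd /= ltn_eqF// eqxx.
apply: (measurableT_comp mh (measurable_fun_pair _ _)).
  exact: measurable_seq_coord.
exact: measurable_seq_coord.
Qed.

(** Invariance is used in density form: the last transition is integrated out, the induction
    hypothesis replaces the previous state by a variable of density [theta], and Tonelli exposes the
    integral of theta(x) k(x, y) over x. *)
Lemma stationary_ge0_integral n (h : R -> \bar R) :
  measurable_fun setT h -> (forall x, 0 <= h x) ->
  \int[Pr]_w h (Y n w) = \int[lebesgue_measure]_x (h x * (theta x)%:E).
Proof.
elim: n h => [|n IH] h mh h0.
  have -> : \int[Pr]_w h (Y 0%N w) = \int[Pr]_w (h (Y 0%N w) * (cst 1%R w)%:E).
    by apply: eq_integral => w _; rewrite mule1.
  apply: (@eq_weighted_integral _ _ _ _ _ _ R Pr lebesgue_measure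
    (Y 0%N) idfun (cst 1%R) theta measurable) => //.
  - exact: measurable_id.
  - by apply/esym/sigma_algebra_id; exact: sigma_algebra_measurable.
  - by move=> *; exact: measurableI.
  - by rewrite probability_integral_cst1// probability_setT ltry.
  - move=> A mA; rewrite probability_integral_cst1; last first.
      by rewrite -[X in measurable X]setTI; exact: measurable_funPT.
    by have [_ HY _] := chainY; rewrite HY// muE.
rewrite (markov_step n (h := fun _ y => h y))//; last exact: measurableT_comp.
have mhk : measurable_fun setT (fun u : R * R => h u.2 * (k u.1 u.2)%:E).
  by apply: emeasurable_funM; [exact: measurableT_comp|exact/measurable_EFinP].
have hk0 u : 0 <= h u.2 * (k u.1 u.2)%:E by rewrite mule_ge0 ?lee_fin.
rewrite (IH (fun x => \int[lebesgue_measure]_y (h y * (k x y)%:E)))//; last 2 first.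
- exact: (measurable_fun_fubini_tonelli_F (m2 := lebesgue_measure)
    (fun u : R * R => h u.2 * (k u.1 u.2)%:E)).
- by move=> x; apply: integral_ge0 => y _; exact: (hk0 (x, y)).
transitivity (\int[lebesgue_measure]_x \int[lebesgue_measure]_y
    (h y * (k x y)%:E * (theta x)%:E)).
  apply: eq_integral => x _; rewrite -ge0_integralZr ?lee_fin//.
  - exact: (measurableT_comp mhk (pair1_measurable x)).
  - by move=> y _; exact: (hk0 (x, y)).
(* The exchange puts the earlier state in the inner integral, where [invariant] evaluates it. *)
rewrite (fubini_tonelli (m1 := lebesgue_measure) (m2 := lebesgue_measure)
    (fun u : R * R => h u.2 * (k u.1 u.2)%:E * (theta u.1)%:E))/=.
- apply: eq_integral => y _.
  under eq_integral do rewrite -muleA -EFinM mulrC.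
  rewrite ge0_integralZl ?invariant//.
  + apply/measurable_EFinP; apply: measurable_funM => //.
    exact: (measurableT_comp mk (pair2_measurable y)).
  + by move=> x _; rewrite lee_fin mulr_ge0.
- apply: emeasurable_funM => //.
  by apply/measurable_EFinP; exact: (measurableT_comp mtheta measurable_fst).
- by move=> u; rewrite mule_ge0 ?lee_fin.
Qed.

Lemma stationary_pair_integral n (h : R -> R -> \bar R) :
  measurable_fun setT (fun u : R * R => h u.1 u.2) -> (forall x y, 0 <= h x y) ->
  \int[Pr]_w h (Y n w) (Y n.+1 w) =
  \int[lebesgue_measure]_x \int[lebesgue_measure]_y
     (h x y * (theta x * k x y)%:E).
Proof.
move=> mh h0; rewrite markov_step//.
have mhk : measurable_fun setT (fun u : R * R => h u.1 u.2 * (k u.1 u.2)%:E).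
  by apply: emeasurable_funM => //; exact/measurable_EFinP.
have hk0 u : 0 <= h u.1 u.2 * (k u.1 u.2)%:E by rewrite mule_ge0 ?lee_fin.
rewrite (stationary_ge0_integral n
  (h := fun x => \int[lebesgue_measure]_y (h x y * (k x y)%:E)))//; last 2 first.
- exact: (measurable_fun_fubini_tonelli_F (m2 := lebesgue_measure)
    (fun u : R * R => h u.1 u.2 * (k u.1 u.2)%:E)).
- by move=> x; apply: integral_ge0 => y _; exact: (hk0 (x, y)).
apply: eq_integral => x _; rewrite -ge0_integralZr ?lee_fin//.
- apply: eq_integral => y _; rewrite -muleA -EFinM; congr (_ * _%:E); ring.
- exact: (measurableT_comp mhk (pair1_measurable x)).
- by move=> y _; exact: (hk0 (x, y)).
Qed.

End stationarity.

(** * Holding times *)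

Section measurable_prod_generators.
Context d1 d2 (T1 : measurableType d1) (T2 : measurableType d2).
Variables (C1 : set (set T1)) (C2 : set (set T2)).
Hypotheses (mC1 : measurable = <<s C1 >>) (C1T : C1 setT).
Hypotheses (mC2 : measurable = <<s C2 >>) (C2T : C2 setT).

(** Since each generator contains the full set, A x T2 and T1 x B are generating rectangles. Both
    projections are thus measurable for the generated sigma-algebra, and so is the identity, as the
    pair of the projections. *)
Lemma measurable_prod_generators :
  @measurable _ (T1 * T2)%type = <<s [set A `*` B | A in C1 & B in C2] >>.
Proof.
set C := [set A `*` B | A in C1 & B in C2].
apply/seteqP; split; last first.
  apply: smallest_sub; first exact: sigma_algebra_measurable.
  move=> _ [A C1A [B C2B <-]]; apply: measurableX.
    by rewrite mC1; exact: sub_sigma_algebra.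
  by rewrite mC2; exact: sub_sigma_algebra.
move=> X mX.
have m1 : measurable_fun [set: g_sigma_algebraType C]
    (fst : g_sigma_algebraType C -> T1).
  apply: (measurability C1) => // _ [A C1A <-].
  apply: sub_sigma_algebra; exists A => //; exists setT => //.
  by rewrite setTI; apply/seteqP; split => [[x y] []|[x y]].
have m2 : measurable_fun [set: g_sigma_algebraType C]
    (snd : g_sigma_algebraType C -> T2).
  apply: (measurability C2) => // _ [A C1A <-].
  by apply: sub_sigma_algebra; exists setT => //; exists A.
have := measurable_fun_pair m1 m2 measurableT mX; rewrite setTI.
by congr (<<s C >> _); apply/seteqP; split => -[].
Qed.

End measurable_prod_generators.

Lemma setX_generators_setI (T1 T2 : Type) (C1 : set (set T1)) (C2 : set (set T2)) :
  setI_closed C1 -> setI_closed C2 ->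
  setI_closed [set A `*` B | A in C1 & B in C2].
Proof.
move=> C1I C2I _ _ [A CA [B CB <-]] [A' CA' [B' CB' <-]].
exists (A `&` A'); first exact: C1I.
by exists (B `&` B'); [exact: C2I|rewrite setXI].
Qed.

Section independence.
Context d (T : measurableType d) (R : realType) (Pr : probability T R).
Variables (Y tau : nat -> {RV Pr >-> R}).
Hypothesis hold : holding_times Y tau.
Local Open Scope ereal_scope.

Lemma holding_times_rect n (B : nat -> set R) : (forall k, measurable (B k)) ->
  Pr (path_of tau @^-1` seq_rect n B) = \prod_(k < n) Pr (tau k @^-1` B k).
Proof.
move=> mB; have := hold.2 n (fun=> setT) B (fun=> measurableT) mB.
have -> : \bigcap_(k < n) (Y k @^-1` setT) = setT :> set T by apply/seteqP; split.
rewrite probability_setT mul1e => <-; congr (Pr _).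
by apply/seteqP; split => [w Bw i /= ni|w Bw i /= ni]; [split => //|]; apply Bw.
Qed.

(** Independence in Fubini form: the joint image of states and holding times and the image of the
    product measure agree on products of rectangles. *)
Lemma independent_ge0_integral n (f : seqT R n * seqT R n -> \bar R) :
  measurable_fun setT f -> (forall u, 0 <= f u) ->
  \int[Pr]_w f (path_of Y w, path_of tau w) =
  \int[Pr]_w \int[Pr]_v f (path_of Y w, path_of tau v).
Proof.
move=> mf f0.
pose phi1 w : seqT R n * seqT R n := (path_of Y w, path_of tau w).
pose phi2 (u : T * T) : seqT R n * seqT R n := (path_of Y u.1, path_of tau u.2).
have mphi1 : measurable_fun setT phi1.
  by apply: measurable_fun_pair; exact: measurable_path_of.
have mphi2 : measurable_fun setT phi2.
  apply: measurable_fun_pair.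
    exact: (measurableT_comp (measurable_path_of _ _) measurable_fst).
  exact: (measurableT_comp (measurable_path_of _ _) measurable_snd).
transitivity (\int[Pr \x Pr]_u (f (phi2 u) * (cst 1%R u)%:E)); last first.
  under eq_integral do rewrite mule1.
  by rewrite fubini_tonelli1//; exact: measurableT_comp.
transitivity (\int[Pr]_w (f (phi1 w) * (cst 1%R w)%:E)).
  by under [RHS]eq_integral do rewrite mule1.
have mrect k (Z : nat -> {RV Pr >-> R}) A : (forall k, measurable (A k)) ->
    measurable (path_of Z @^-1` seq_rect k A).
  move=> mA; apply: bigcap_measurableType => i _.
  by rewrite -[X in measurable X]setTI; exact: measurable_funPT.
apply: (@eq_weighted_integral _ _ _ _ _ (seqT R n * seqT R n)%type _ _ _ _ _ _ _
  [set A `*` B | A in seq_rects R n & B in seq_rects R n]) => //.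
- apply: measurable_prod_generators => //; exact: seq_rectsT.
- by apply: setX_generators_setI; exact: seq_rectsI.
- exists setT; first exact: seq_rectsT.
  by exists setT; [exact: seq_rectsT|rewrite setXTT].
- by rewrite probability_integral_cst1// probability_setT ltry.
- move=> _ [_ [A mA ->] [_ [B mB ->] <-]].
  rewrite probability_integral_cst1; last first.
    rewrite -[X in measurable X]setTI; apply: mphi1 => //.
    apply: measurableX; apply: sub_sigma_algebra; first by exists A.
    by exists B.
  have -> : phi2 @^-1` (seq_rect n A `*` seq_rect n B) =
      (path_of Y @^-1` seq_rect n A) `*` (path_of tau @^-1` seq_rect n B) by [].
  have -> : \int[Pr \x Pr]_(u in (path_of Y @^-1` seq_rect n A) `*`
      (path_of tau @^-1` seq_rect n B)) (cst 1%R u)%:E =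
      Pr (path_of Y @^-1` seq_rect n A) * Pr (path_of tau @^-1` seq_rect n B).
    rewrite (eq_integral (cst 1%E))// integral_cst ?mul1e; last first.
      by apply: measurableX; exact: mrect.
    by apply: product_measure1E; exact: mrect.
  rewrite holding_times_rect// !preimage_path_of -(hold.2 n A B mA mB).
  congr (Pr _); apply/seteqP; split => [w [Aw Bw] i /= ni|w ABw].
    by split; [exact: Aw|exact: Bw].
  by split => i /= ni; have [] := ABw i ni.
Qed.

(** A rectangle in the first n holding times together with a condition on the next one is a
    rectangle in n.+1 holding times, whose probability factorizes. *)
Lemma fresh_holding_time n (f : seqT R n * R -> \bar R) :
  measurable_fun setT f -> (forall u, 0 <= f u) ->
  \int[Pr]_w f (path_of tau w, tau n w) =
  \int[Pr]_w \int[Pr]_v f (path_of tau w, tau n v).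
Proof.
move=> mf f0.
pose phi1 w : seqT R n * R := (path_of tau w, tau n w).
pose phi2 (u : T * T) : seqT R n * R := (path_of tau u.1, tau n u.2).
have mphi1 : measurable_fun setT phi1.
  by apply: measurable_fun_pair => //; exact: measurable_path_of.
have mphi2 : measurable_fun setT phi2.
  apply: measurable_fun_pair.
    exact: (measurableT_comp (measurable_path_of _ _) measurable_fst).
  exact: measurableT_comp.
transitivity (\int[Pr \x Pr]_u (f (phi2 u) * (cst 1%R u)%:E)); last first.
  under eq_integral do rewrite mule1.
  by rewrite fubini_tonelli1//; exact: measurableT_comp.
transitivity (\int[Pr]_w (f (phi1 w) * (cst 1%R w)%:E)).
  by under [RHS]eq_integral do rewrite mule1.
have mrect k (Z : nat -> {RV Pr >-> R}) A : (forall k, measurable (A k)) ->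
    measurable (path_of Z @^-1` seq_rect k A).
  move=> mA; apply: bigcap_measurableType => i _.
  by rewrite -[X in measurable X]setTI; exact: measurable_funPT.
have mtau B : measurable B -> measurable (tau n @^-1` B).
  by move=> mB; rewrite -[X in measurable X]setTI; exact: measurable_funPT.
apply: (@eq_weighted_integral _ _ _ _ _ (seqT R n * R)%type _ _ _ _ _ _ _
  [set A `*` B | A in seq_rects R n & B in measurable]) => //.
- apply: measurable_prod_generators => //; first exact: seq_rectsT.
  by apply/esym/sigma_algebra_id; exact: sigma_algebra_measurable.
- apply: setX_generators_setI; first exact: seq_rectsI.
  by move=> *; exact: measurableI.
- exists setT; first exact: seq_rectsT.
  by exists setT; [exact: measurableT|rewrite setXTT].
- by rewrite probability_integral_cst1// probability_setT ltry.
- move=> _ [_ [A mA ->] [B mB <-]].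
  rewrite probability_integral_cst1; last first.
    rewrite -[X in measurable X]setTI; apply: mphi1 => //.
    by apply: measurableX => //; apply: sub_sigma_algebra; exists A.
  have -> : phi2 @^-1` (seq_rect n A `*` B) =
      (path_of tau @^-1` seq_rect n A) `*` (tau n @^-1` B) by [].
  have -> : \int[Pr \x Pr]_(u in (path_of tau @^-1` seq_rect n A) `*`
      (tau n @^-1` B)) (cst 1%R u)%:E =
      Pr (path_of tau @^-1` seq_rect n A) * Pr (tau n @^-1` B).
    rewrite (eq_integral (cst 1%E))// integral_cst ?mul1e; last first.
      by apply: measurableX; [exact: mrect|exact: mtau].
    by apply: product_measure1E; [exact: mrect|exact: mtau].
  rewrite holding_times_rect//.
  pose A' k := if k == n then B else A k.
  have mA' k : measurable (A' k) by rewrite /A'; case: ifP.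
  have := holding_times_rect n.+1 mA'; rewrite big_ord_recr /= /A' eqxx.
  under eq_bigr => i _ do rewrite ltn_eqF//.
  move=> <-; congr (Pr _).
  apply/seteqP; split => [w [Aw Bw] i /=|w Aw].
    by rewrite ltnS leq_eqVlt; case: eqVneq => [-> _|_ /= ni]; [|exact: Aw].
  split.
    move=> i /= ni; have := Aw i; rewrite /= ltn_eqF// ltnS ltnW//.
    exact.
  by have := Aw n; rewrite /= eqxx ltnSn; exact.
Qed.

End independence.

Section exponential_time.
Context d (T : measurableType d) (R : realType) (Pr : probability T R).
Variable t : {RV Pr >-> R}.
Hypothesis tE : forall B, measurable B -> Pr (t @^-1` B) = exponential_prob 1 B.
Local Open Scope ereal_scope.

Let Pr_lt0 : Pr (t @^-1` `]-oo, 0%R[) = 0.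
Proof.
rewrite tE// /exponential_prob integral0_eq// => x.
by rewrite /= in_itv/= => x0; rewrite lt0_exponential_pdf.
Qed.

Let mpre B : measurable B -> measurable (t @^-1` B).
Proof. by move=> mB; rewrite -[X in measurable X]setTI; exact: measurable_funPT. Qed.

Let Pr_le_itv c : (0 <= c)%R ->
  Pr (t @^-1` `]-oo, c]) = exponential_prob 1 `[0%R, c].
Proof.
move=> c0; rewrite -tE//.
have -> : `]-oo, c]%classic = `]-oo, 0%R[%classic `|` `[0%R, c]%classic.
  by rewrite -itv_bndbnd_setU//= bnd_simp.
rewrite preimage_setU measureU; [by rewrite [X in X + _]Pr_lt0 add0e|exact: mpre..|].
apply/seteqP; split => // w /=; rewrite !in_itv/= => -[tw /andP[]].
by rewrite leNgt tw.
Qed.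

Lemma exponential_le c : (0 <= c)%R ->
  Pr (t @^-1` `]-oo, c]) = (1 - expR (- c))%:E.
Proof.
move=> c0; rewrite Pr_le_itv//; move: c0; rewrite le_eqVlt => /predU1P[<-|c0].
  by rewrite /exponential_prob set_itv1 integral_set1 oppr0 expR0 subrr.
by rewrite exponential_prob_itv0c// mulN1r.
Qed.

Lemma exponential_gt0 : {ae Pr, forall w, (0 < t w)%R}.
Proof.
exists (t @^-1` `]-oo, 0%R]); split; first exact: mpre.
  by rewrite exponential_le// oppr0 expR0 subrr.
by move=> w /= /negP; rewrite -leNgt in_itv.
Qed.

(** At rate 1 the tail P(tau > r) = exp(-r) coincides with the exponential density, so the tail
    formula for the mean of min(tau, c) integrates the density over [0, c]. The maximum with 0 makes
    the variable nonnegative everywhere, whereas [t] is so only almost surely. *)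
Lemma exponential_min c : (0 <= c)%R ->
  \int[Pr]_w (Num.min (Num.max (t w) 0) c)%:E = Pr (t @^-1` `]-oo, c]).
Proof.
move=> c0; pose f w := Num.min (Num.max (t w) 0%R) c.
have mf : measurable_fun setT f.
  by apply: measurable_minr => //; apply: measurable_maxr.
pose X : {mfun T >-> R} := HB.pack f (isMeasurableFun.Build _ _ _ _ f mf).
have X0 w : (0 <= X w)%R by rewrite /= /f le_min le_max lexx orbT.
have := ge0_expectation_ccdf (P := Pr) (X := X) X0.
rewrite expectation_def => ->.
rewrite Pr_le_itv// /exponential_prob.
(* At r = c the truncated variable has tail 0 but the density is positive; the half-open interval
   makes the two integrands equal pointwise. *)
rewrite -(@integral_itv_bndo_bndc _ (BLeft 0%R) c); last first.
  by apply/measurable_EFinP; apply: measurable_funTS; exact: measurable_exponential_pdf.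
rewrite [LHS]integral_mkcond [RHS]integral_mkcond.
apply: eq_integral => r _; rewrite !patchE.
have [r0|r0] := leP 0%R r; last first.
  by rewrite !memNset//= in_itv/= leNgt r0.
have ccdfE : ccdf (P := Pr) X r = Pr (f @^-1` `]r, +oo[) by [].
rewrite ccdfE (mem_set (_ : [set` `[0%R, +oo[] r)) /= ?in_itv /= ?r0 //.
have [cr|rc] := leP c r.
  rewrite memNset/= ?in_itv/= ?r0/= ?ltNge ?cr//.
  rewrite (_ : f @^-1` `]r, +oo[ = set0) ?measure0//.
  apply/seteqP; split => // w /=; rewrite in_itv/= andbT /f lt_min => /andP[_].
  by rewrite ltNge cr.
rewrite mem_set/= ?in_itv/= ?r0 ?rc//.
rewrite exponential_pdfE//.
have -> : f @^-1` `]r, +oo[ = ~` (t @^-1` `]-oo, r]).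
  apply/seteqP; split => w /=; rewrite !in_itv/= /f andbT.
    rewrite lt_min lt_max => /andP[/orP[rt _|/(le_lt_trans r0)]].
      by apply/negP; rewrite -ltNge.
    by rewrite ltxx.
  by move=> /negP; rewrite -ltNge => rt; rewrite lt_min lt_max rt rc.
rewrite probability_setC; last exact: mpre.
by rewrite exponential_le// -EFinB mul1r mulN1r opprB addrC subrK.
Qed.

End exponential_time.

(** * Renewal argument for the expected number of jumps *)

Section renewal.
Context d (T : measurableType d) (R : realType) (Pr : probability T R).
Variables (Y tau : nat -> {RV Pr >-> R}).
Hypothesis hold : holding_times Y tau.
Variable t : R.
Hypothesis t0 : 0 <= t.
Local Open Scope ereal_scope.

Let S n w := seq_run (path_of tau w) n.

Lemma seq_runS (z : nat -> R) n : seq_run z n.+1 = (seq_run z n + z n)%R.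
Proof. by rewrite /seq_run big_ord_recr. Qed.

Lemma measurable_seq_run n m : (n <= m)%N ->
  measurable_fun setT (fun z : seqT R m => seq_run z n).
Proof.
move=> nm; apply: measurable_sum => i.
by apply: measurable_seq_coord; exact: leq_trans nm.
Qed.

Lemma measurable_jump_time n : measurable_fun setT (S n).
Proof.
exact: (measurableT_comp (measurable_seq_run (leqnn n)) (measurable_path_of tau n)).
Qed.

Lemma holding_times_gt0 : {ae Pr, forall w, forall k, (0 < tau k w)%R}.
Proof.
apply/ae_foralln => k; apply: exponential_gt0 => B mB; exact: hold.1.
Qed.

Lemma seq_run_ge0 (z : nat -> R) n : (forall k, 0 < z k)%R -> (0 <= seq_run z n)%R.
Proof. by move=> z0; apply: sumr_ge0 => i _; exact: ltW. Qed.

Let mle n : measurable [set w | S n w <= t]%R.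
Proof.
rewrite (_ : [set _ | _] = S n @^-1` `]-oo, t]).
  by rewrite -[X in measurable X]setTI; exact: measurable_jump_time.
by apply/seteqP; split => w /=; rewrite in_itv.
Qed.

(** The part of [0, t] that remains after the n-th jump time. It takes a pair so that the integrand
    of [renewal_step] has the shape required by [fresh_holding_time]. *)
Let overshoot n (u : seqT R n * R) := Num.max (t - seq_run u.1 n)%R 0%R.

Let mover n : measurable_fun setT (@overshoot n).
Proof.
apply: measurable_maxr => //; apply: measurable_funB => //.
exact: (measurableT_comp (measurable_seq_run (leqnn n)) measurable_fst).
Qed.

Let over0 n u : (0 <= @overshoot n u)%R. Proof. by rewrite le_max lexx orbT. Qed.

(* Since P(tau <= c) = E[min(tau, c)] for c >= 0, the probability of S_(n+1) <= t
   is the mean of min(S_(n+1), t) - min(S_n, t), which telescopes. *)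
Let renewal_step n :
  \int[Pr]_w (Num.min (Num.max (tau n w) 0) (overshoot (n := n) (path_of tau w, 0%R)))%:E
  = Pr [set w | S n.+1 w <= t]%R.
Proof.
rewrite (@fresh_holding_time _ _ _ _ _ _ hold n (fun u =>
  (Num.min (Num.max u.2 0) (overshoot u))%:E)); last 2 first.
- apply/measurable_EFinP; apply: measurable_minr => //.
  by apply: measurable_maxr.
- by move=> u; rewrite lee_fin le_min over0 le_max lexx orbT.
pose B n := [set u : seqT R n * R | (u.2 <= overshoot u)%R].
have mB : measurable (B n).
  rewrite (_ : B n = (fun u => overshoot u - u.2)%R @^-1` `[0%R, +oo[).
    rewrite -[X in measurable X]setTI; apply: measurable_funB => //.
  by apply/seteqP; split => w /=; rewrite in_itv/= andbT subr_ge0.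
transitivity (\int[Pr]_w \int[Pr]_v (\1_(B n) (path_of tau w, tau n v) : R)%:E).
  apply: eq_integral => w _.
  transitivity (Pr (tau n @^-1` `]-oo, overshoot (n := n) (path_of tau w, 0%R)])).
    have tauE B' : measurable B' -> Pr (tau n @^-1` B') = exponential_prob 1 B'.
      exact: hold.1.
    exact: (exponential_min tauE (@over0 n (path_of tau w, 0%R))).
  have -> : (fun v => (\1_(B n) (path_of tau w, tau n v) : R)%:E) =
      (fun v => (\1_(tau n @^-1` `]-oo, overshoot (n := n) (path_of tau w, 0%R)]) v : R)%:E).
    apply/funext => v; rewrite !indicE; congr ((nat_of_bool _)%:R%:E).
  rewrite integral_indic ?setIT//.
  by rewrite -[X in measurable X]setTI; exact: measurable_funPT.
rewrite -(@fresh_holding_time _ _ _ _ _ _ hold n (fun u => (\1_(B n) u : R)%:E)).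
- have mpB : measurable [set w | B n (path_of tau w, tau n w)].
    rewrite -[X in measurable X]setTI.
    apply: (measurable_fun_pair (measurable_path_of tau n) _ measurableT mB).
    exact: measurable_funPT.
  rewrite -(setIT [set w | (S n.+1 w <= t)%R]) -integral_indic//.
  apply: ge0_ae_eq_integral => //.
  + by apply/measurable_EFinP; exact: (measurable_indic mpB).
  + by apply/measurable_EFinP; exact: measurable_indic.
  + apply: filterS holding_times_gt0 => w tw _.
    rewrite !indicE; congr ((nat_of_bool _)%:R%:E).
    apply/idP/idP; rewrite !inE /B /= /overshoot/= /S seq_runS le_max;
      have := tw n; rewrite -/(path_of tau w n);
      move: (seq_run (path_of tau w) n) (path_of tau w n) => s x x0 h.
      case/orP: h; first by lra.
      by rewrite leNgt x0.
    by apply/orP; left; lra.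
- by apply/measurable_EFinP; exact: measurable_indic.
- by move=> u; rewrite lee_fin.
Qed.

Let truncated_time n w := Num.min (Num.max (S n w) 0%R) t.

Let mtrunc n : measurable_fun setT (truncated_time n).
Proof.
by apply: measurable_minr => //; apply: measurable_maxr => //; exact: measurable_jump_time.
Qed.

Let trunc0 n w : (0 <= truncated_time n w)%R.
Proof. by rewrite le_min t0 le_max lexx orbT. Qed.

Let sum_renewal n :
  \sum_(i < n) Pr [set w | S i.+1 w <= t]%R = \int[Pr]_w (truncated_time n w)%:E.
Proof.
elim: n => [|n IH].
  rewrite big_ord0 integral0_eq// => w _.
  by rewrite /truncated_time /S /seq_run big_ord0 maxxx min_l.
have mstep : measurable_fun setT (fun w =>
    (Num.min (Num.max (tau n w) 0) (overshoot (n := n) (path_of tau w, 0%R)))%:E).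
  apply/measurable_EFinP; apply: measurable_minr.
    by apply: measurable_maxr.
  apply: (measurableT_comp (@mover n) (measurable_fun_pair _ _)) => //.
  exact: measurable_path_of.
have step0 w : 0 <= (Num.min (Num.max (tau n w) 0)
    (overshoot (n := n) (path_of tau w, 0%R)))%:E.
  by rewrite lee_fin le_min over0 le_max lexx orbT.
rewrite big_ord_recr/= IH -renewal_step -ge0_integralD//; last 2 first.
- by move=> w _; rewrite lee_fin.
- by apply/measurable_EFinP.
apply: ge0_ae_eq_integral => //.
- by apply: emeasurable_funD => //; apply/measurable_EFinP.
- by apply/measurable_EFinP.
- by move=> w _; rewrite adde_ge0// lee_fin.
- by move=> w _; rewrite lee_fin.
apply: filterS holding_times_gt0 => w tw _.
rewrite -EFinD; congr (_%:E).
have := @seq_run_ge0 (path_of tau w) n tw; have := tw n.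
rewrite /truncated_time /overshoot/= /S seq_runS -!/(path_of tau w n).
move: (seq_run _ _) (path_of tau w n) => s x x0 s0.
have x0' := ltW x0; have sx0 := addr_ge0 s0 x0'.
rewrite (max_l sx0) (max_l s0) (max_l x0').
(* The truncated time grows by x if s + x <= t, by t - s if s <= t < s + x, and by 0 if t < s. *)
have [sx|sx] := leP (s + x)%R t.
  by rewrite !min_l ?max_l//; lra.
have [st|st] := leP s t; last first.
  by rewrite max_r ?min_r ?addr0//; lra.
by rewrite max_l ?min_r//; lra.
Qed.

Let u n := fine (Pr [set w | S n w <= t]%R).

Let uE n : Pr [set w | S n w <= t]%R = (u n)%:E.
Proof. by rewrite fineK// fin_num_measure. Qed.

Let u0 n : (0 <= u n)%R. Proof. exact: fine_ge0. Qed.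

Let sum_u n : (\sum_(i < n) u i.+1)%:E = \int[Pr]_w (truncated_time n w)%:E.
Proof. by rewrite -sum_renewal -sumEFin; apply: eq_bigr => i _; rewrite uE. Qed.

Let sum_u_le n : (\sum_(i < n) u i.+1 <= t)%R.
Proof.
rewrite -lee_fin sum_u.
apply: (@le_trans _ _ (\int[Pr]_w (cst t%:E w))); last first.
  by rewrite integral_cst// [X in _ * X]probability_setT mule1.
apply: ge0_le_integral => //.
- by move=> w _; rewrite lee_fin.
- by apply/measurable_EFinP.
- by move=> w _; rewrite lee_fin ge_min lexx orbT.
Qed.

(** The truncated time equals t as soon as the n-th jump comes after t. *)
Let sum_u_ge n : (t * (1 - u n) <= \sum_(i < n) u i.+1)%R.
Proof.
rewrite -lee_fin sum_u.
have -> : (t * (1 - u n))%:E = t%:E * Pr (~` [set w | S n w <= t]%R).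
  by rewrite probability_setC// uE -EFinB -EFinM.
rewrite -integral_cst ?(integral_mkcond (~` _)); last exact: measurableC.
apply: ge0_le_integral => //.
- by move=> w _; rewrite patchE; case: ifPn => // _; rewrite lee_fin.
- by apply/(measurable_restrict _ _ _); rewrite ?setIT//; exact: measurableC.
- by apply/measurable_EFinP.
- move=> w _; rewrite patchE; case: ifPn; last by rewrite lee_fin.
  rewrite inE /= => /negP; rewrite -ltNge lee_fin le_min lexx andbT le_max => h.
  by rewrite (ltW h).
Qed.

(** The partial sums increase and are bounded by t, so the series converges and its terms tend to
    0. *)
Let cvg_u : u n @[n --> \oo] --> 0%R.
Proof.
rewrite -(cvg_shiftS u); apply: cvg_series_cvg_0.
apply: nondecreasing_is_cvgn.
  apply/nondecreasing_seqP => n.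
  by rewrite /series/= big_nat_recr//= lerDl.
by exists t => _ [n _ <-]; rewrite /series/= big_mkord.
Qed.

(** The n-th jump time lies before t for as many indices n >= 1 as there are jumps, so the series is
    their expected number. Its partial sums are the means of truncated jump times, squeezed between
    t (1 - [u n]) and t. *)
Lemma expected_number_of_jumps :
  \sum_(n <oo) Pr [set w | S n.+1 w <= t]%R = t%:E.
Proof.
apply/cvg_lim => //.
rewrite (_ : (fun n => _) = EFin \o (fun n => \sum_(i < n) u i.+1)%R); last first.
  apply/funext => n; rewrite /= big_mkord -sumEFin.
  by apply: eq_bigr => i _; rewrite uE.
apply: cvg_EFin; first exact: nearW.
apply: (@squeeze_cvgr _ _ _ _ (fun n => t * (1 - u n))%R (cst t)).
- by apply: nearW => n /=; rewrite sum_u_ge sum_u_le.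
- have : (t * (1 - u n))%R @[n --> \oo] --> (t * (1 - 0))%R.
    by apply: cvgMr; apply: cvgB => //; exact: cvg_cst.
  by rewrite subr0 mulr1.
- exact: cvg_cst.
Qed.

(** The event that no jump time exceeds t lies in each event S_n <= t, whose probability tends to
    0. *)
Lemma finitely_many_jumps : {ae Pr, forall w, exists n, (t < S n w)%R}.
Proof.
exists (\bigcap_n [set w | (S n w <= t)%R]); split.
- by apply: bigcapT_measurable.
- apply/eqP; rewrite eq_le measure_ge0 andbT.
  have : (u n)%:E @[n --> \oo] --> 0%:E by apply: cvg_EFin => //; exact: nearW.
  move=> /cvg_lim u_lim; rewrite -[X in _ <= X]/(0%:E) -u_lim//; apply: lime_ge.
    by apply/cvg_ex; exists 0%:E; apply: cvg_EFin => //; exact: nearW.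
  apply: nearW => n; rewrite -uE; apply: le_measure; rewrite ?inE//.
    exact: bigcapT_measurable.
  exact: bigcap_inf.
- move=> w /= nw n _ /=; rewrite leNgt; apply/negP => tn; apply: nw.
  by exists n.
Qed.
End renewal.

(** * The path density as a limit along grids *)

Section discretization.
Context {R : realType}.
Variable g : R -> R -> R.

Definition grid_time (t : R) (n k : nat) : {nonneg R} :=
  NngNum (max0_ge0 (t * k%:R / n.+1%:R)).

Definition grid_ratio (t : R) (n : nat) (x : {nonneg R} -> R) : R :=
  \prod_(k < n.+1) g (x (grid_time t n k)) (x (grid_time t n k.+1)).

Lemma grid_timeE t n k : 0 <= t -> (grid_time t n k)%:num = t * k%:R / n.+1%:R.
Proof. by move=> t0; rewrite /= max_r// divr_ge0// mulr_ge0. Qed.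

Lemma grid_time_le t n k : 0 <= t -> (k <= n.+1)%N -> (grid_time t n k)%:num <= t.
Proof.
move=> t0 kn; rewrite grid_timeE// -mulrA ler_piMr// ler_pdivrMr ?mul1r ?ler_nat//.
Qed.

Lemma seq_run_le (z : nat -> R) n m : (forall k, 0 < z k) -> (n <= m)%N ->
  seq_run z n <= seq_run z m.
Proof.
move=> z0; elim: m => [|m IH]; first by rewrite leqn0 => /eqP ->.
rewrite leq_eqVlt => /predU1P[->//|]; rewrite ltnS => /IH h.
by rewrite seq_runS (le_trans h)// lerDl ltW.
Qed.

Lemma jump_index (z : nat -> R) n (s : R) : 0 <= s -> s < seq_run z n ->
  exists2 j, (j < n)%N & seq_run z j <= s < seq_run z j.+1.
Proof.
elim: n => [s0|n IH s0 sn]; first by rewrite /seq_run big_ord0 ltNge s0.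
have [ns|sn'] := leP (seq_run z n) s; first by exists n => //; rewrite ns.
by have [j jn sj] := IH s0 sn'; exists j => //; exact: ltnW.
Qed.

Lemma jump_index_mono (z : nat -> R) i j (s s' : R) : (forall k, 0 < z k) ->
  s <= s' -> seq_run z i <= s -> s' < seq_run z j.+1 -> (i <= j)%N.
Proof.
move=> z0 ss is_ sj; rewrite leqNgt; apply/negP => ji.
have := seq_run_le z0 ji; lra.
Qed.

Lemma min_holding_time (z : nat -> R) n : (forall k, 0 < z k) ->
  exists2 e, 0 < e & forall k, (k < n)%N -> e <= z k.
Proof.
move=> z0; elim: n => [|n [e e0 IH]]; first by exists 1.
exists (Num.min e (z n)); first by rewrite lt_min e0 z0.
move=> k; rewrite ltnS leq_eqVlt => /predU1P[->|kn]; rewrite ge_min ?lexx ?orbT//.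
by rewrite IH.
Qed.

Hypothesis g1 : forall x, g x x = 1.

(** Once the mesh is smaller than each of the first N.+1 holding times, a grid step contains at most
    one jump. It contributes g(x, x) = 1 without a jump and the factor of that jump otherwise, so
    the grid product is eventually equal to the path product. *)
Lemma near_grid_ratio (t : R) (y z : nat -> R) (x : {nonneg R} -> R) (N : nat) :
  0 <= t -> (forall k, 0 < z k) ->
  (forall n (s : {nonneg R}), seq_run z n <= s%:num < seq_run z n.+1 -> x s = y n) ->
  seq_run z N <= t < seq_run z N.+1 ->
  \forall n \near \oo, grid_ratio t n x = path_ratio g N y.
Proof.
move=> t0 z0 xy /andP[Nt tN].
have [e e0 ez] := min_holding_time N.+1 z0.
(* Beyond this rank n.+1 exceeds t / e, so the mesh t / n.+1 is below e. *)
exists (Num.truncn (t / e)).+1 => // n /= en.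
have mesh : t / n.+1%:R < e.
  rewrite ltr_pdivrMr// mulrC -ltr_pdivrMr//.
  by rewrite (lt_le_trans (truncnS_gt _))// ler_nat ltnW.
have gridS k : (grid_time t n k.+1)%:num = (grid_time t n k)%:num + t / n.+1%:R.
  by rewrite !grid_timeE// -natr1; ring.
have mesh0 : 0 <= t / n.+1%:R by rewrite divr_ge0.
(* Generalized for induction along the grid: up to grid point k, the product is that of the j jumps
   already made. The last grid point is t itself, with j = N. *)
suff H k : (k <= n.+1)%N -> forall j,
    seq_run z j <= (grid_time t n k)%:num < seq_run z j.+1 ->
    \prod_(i < k) g (x (grid_time t n i)) (x (grid_time t n i.+1)) =
    path_ratio g j y.
  apply: H => //; rewrite grid_timeE// mulfK ?pnatr_eq0//; exact/andP.
elim: k => [_ j|k IH kn j].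
  rewrite grid_timeE// mulr0 mul0r => /andP[j0 _].
  suff -> : j = 0%N by rewrite /path_ratio !big_ord0.
  by case: j j0 => // j; rewrite seq_runS leNgt ltr_wpDl// seq_run_ge0.
move=> jk; have /andP[jk1 jk2] := jk.
have kt := grid_time_le t0 kn.
have jN : (j <= N)%N by apply: (jump_index_mono z0 kt).
have ktS : (grid_time t n k)%:num < seq_run z N.+1.
  by apply: le_lt_trans tN; apply: grid_time_le => //; exact: ltnW.
have [|i iN ik] := jump_index _ ktS; first by [].
have /andP[ik1 ik2] := ik.
rewrite big_ord_recr/= (IH (ltnW kn) _ ik) (xy _ _ ik) (xy _ _ jk).
have ij : (i <= j)%N.
  by apply: (jump_index_mono z0 _ ik1 jk2); rewrite gridS lerDl.
move: ij; rewrite leq_eqVlt => /predU1P[->|ij]; first by rewrite g1 mulr1.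
move: ij; rewrite leq_eqVlt => /predU1P[<-|ij]; first by rewrite path_ratioS.
(* With two jumps in one grid step, the whole holding time [z i.+1], at least e, would fit into a
   mesh smaller than e. *)
exfalso; have := seq_run_le z0 ij; rewrite seq_runS.
have := ez i.+1; rewrite ltnS (leq_trans (ltnW ij) jN) => /(_ isT).
move: jk1 mesh ik2; rewrite gridS.
move: (seq_run z j) (seq_run z i.+1) (z i.+1) (t / n.+1%:R) ((grid_time t n k)%:num) => a b c m gk.
by clear -R; lra.
Qed.

End discretization.

Section joint_density.
Context d1 d2 (T1 : measurableType d1) (T2 : measurableType d2) (R : realType).
Variables (Pr1 : probability T1 R) (Pr2 : probability T2 R).
Variables (Y1 tau1 : nat -> {RV Pr1 >-> R}) (Y2 tau2 : nat -> {RV Pr2 >-> R}).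
Variables (mu : set R -> \bar R) (K1 K2 : R -> set R -> \bar R).
Variables (k g : R -> R -> R).
Hypothesis chainY1 : markov_chain mu K1 Y1.
Hypothesis chainY2 : markov_chain mu K2 Y2.
Hypothesis hold1 : holding_times Y1 tau1.
Hypothesis hold2 : holding_times Y2 tau2.
Hypothesis K1E : forall x B, x \in `[0, 1] -> measurable B ->
  K1 x B = (\int[lebesgue_measure]_(y in B) (k x y)%:E)%E.
Hypothesis K2E : forall x B, x \in `[0, 1] -> measurable B ->
  K2 x B = (\int[lebesgue_measure]_(y in B) (k x y * g x y)%:E)%E.
Hypothesis mk : measurable_fun setT (fun u : R * R => k u.1 u.2).
Hypothesis k0 : forall x y, 0 <= k x y.
Hypothesis mg : measurable_fun setT (fun u : R * R => g u.1 u.2).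
Hypothesis g0 : forall x y, 0 <= g x y.
Local Open Scope ereal_scope.

Lemma holding_times_law n (f : seqT R n -> \bar R) :
  measurable_fun setT f -> (forall z, 0 <= f z) ->
  \int[Pr2]_w f (path_of tau2 w) = \int[Pr1]_w f (path_of tau1 w).
Proof.
move=> mf f0.
apply: (@eq_integral_image _ _ _ _ _ (seqT R n) _ _ _ _ _ (seq_rects R n)) => //.
- exact: measurable_path_of.
- exact: measurable_path_of.
- exact: seq_rectsI.
- exact: seq_rectsT.
- move=> _ [B mB ->].
  rewrite (holding_times_rect hold1)// (holding_times_rect hold2)//.
  by apply: eq_bigr => i _; rewrite hold1.1// hold2.1.
Qed.

(** By independence the holding times can be integrated separately; they have the same law in both
    processes, so the whole density comes from the chains. *)
Lemma joint_density n (f : seqT R n.+1 * seqT R n.+1 -> \bar R) :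
  measurable_fun setT f -> (forall u, 0 <= f u) ->
  \int[Pr2]_w f (path_of Y2 w, path_of tau2 w) =
  \int[Pr1]_w (f (path_of Y1 w, path_of tau1 w) *
               (path_ratio g n (path_of Y1 w))%:E).
Proof.
move=> mf f0.
pose H y := \int[Pr1]_v f (y, path_of tau1 v : seqT R n.+1).
have mfy y : measurable_fun setT (fun z => f (y, z)).
  exact: (measurableT_comp mf (pair1_measurable y)).
have mH : measurable_fun setT H.
  apply: (measurable_fun_fubini_tonelli_F (m2 := Pr1)
    (fun u : seqT R n.+1 * T1 => f (u.1, path_of tau1 u.2 : seqT R n.+1))) => //.
  apply: (measurableT_comp mf (measurable_fun_pair _ _)) => //.
  exact: (measurableT_comp (measurable_path_of _ _) measurable_snd).
have H0 y : 0 <= H y by exact: integral_ge0.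
rewrite (independent_ge0_integral hold2)//.
transitivity (\int[Pr2]_w H (path_of Y2 w)).
  by apply: eq_integral => w _; exact: (holding_times_law (mfy _)).
rewrite (chain_density chainY1 chainY2 K1E K2E)//.
pose f' (u : seqT R n.+1 * seqT R n.+1) := f u * (path_ratio g n u.1)%:E.
have -> : \int[Pr1]_w (f (path_of Y1 w, path_of tau1 w) *
               (path_ratio g n (path_of Y1 w))%:E) =
          \int[Pr1]_w f' (path_of Y1 w, path_of tau1 w) by [].
have mf' : measurable_fun setT f'.
  apply: emeasurable_funM => //; apply/measurable_EFinP.
  exact: (measurableT_comp (measurable_path_ratio mg (ltnSn n)) measurable_fst).
rewrite (independent_ge0_integral hold1)//; last first.
  by move=> u; rewrite mule_ge0// lee_fin path_ratio_ge0.
apply: eq_integral => w _; rewrite /H /f' /= ge0_integralZr//.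
- exact: (measurableT_comp (mfy _) (measurable_path_of _ _)).
- by rewrite lee_fin path_ratio_ge0.
Qed.

End joint_density.

Section cylinders.
Context {R : realType}.
Variable t : R.

Definition cylinder (m : nat) (s : nat -> {nonneg R}) (B : nat -> set R) :
    set (cadlag_path R) :=
  \bigcap_(i < m) [set w : cadlag_path R | B i (w (s i))].

(** Conditions on a single coordinate generate the sigma-algebra but are not stable under
    intersection; finitely many of them at once are. *)
Definition cylinders : set (set (cadlag_path R)) :=
  [set A | exists m s B, [/\ forall i, (s i)%:num <= t,
     forall i, measurable (B i) & A = cylinder m s B]].

Lemma cylindersI : setI_closed cylinders.
Proof.
move=> _ _ [m [s [B [st mB ->]]]] [m' [s' [B' [st' mB' ->]]]].
exists (m + m')%N, (fun i => if (i < m)%N then s i else s' (i - m)%N),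
  (fun i => if (i < m)%N then B i else B' (i - m)%N); split.
- by move=> i; case: ifP.
- by move=> i; case: ifP.
- apply/seteqP; split => [w [Bw Bw'] i /= imm|w Bw].
    case: ltnP => im; first exact: Bw.
    by apply: Bw'; rewrite /= ltn_subLR.
  split => i /= im.
    by have := Bw i; rewrite /= im ltn_addr//; exact.
  by have := Bw (m + i)%N; rewrite /= ltn_add2l im ltnNge leq_addr/= addKn; exact.
Qed.

Hypothesis t0 : 0 <= t.

Lemma cylindersT : cylinders setT.
Proof.
exists 0%N, (fun=> 0%:nng), (fun=> setT); split => //.
by apply/seteqP; split.
Qed.

Lemma measurable_upto_cylinders :
  @measurable _ (pathT_upto t) = <<s cylinders >>.
Proof.
apply/seteqP; split; apply: smallest_sub; try exact: smallest_sigma_algebra.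
- move=> _ [s [st [B mB ->]]]; apply: sub_sigma_algebra.
  exists 1%N, (fun=> s), (fun=> B); split => //.
  by apply/seteqP; split => [w Bw i _ //|w /(_ 0%N)]; apply.
- move=> _ [m [s [B [st mB ->]]]].
  apply: (@bigcap_measurableType _ (pathT_upto t)) => i _.
  apply: sub_sigma_algebra; exists (s i); split; [exact: st|by exists (B i)].
Qed.

Lemma measurable_coord_upto (s : {nonneg R}) : s%:num <= t ->
  measurable_fun setT (fun w : pathT_upto t => (w : cadlag_path R) s).
Proof.
move=> st _ B mB; rewrite setTI; apply: sub_sigma_algebra.
by exists s; split => //; exists B.
Qed.

Variable g : R -> R -> R.
Hypothesis mg : measurable_fun setT (fun u : R * R => g u.1 u.2).

(** The upper limit exists for every path and is measurable; on the regular samples below it is a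
    true limit. *)
Definition path_density (w : pathT_upto t) : \bar R :=
  limn_esup (fun n => (grid_ratio g t n (w : cadlag_path R))%:E).

Lemma measurable_path_density : measurable_fun setT path_density.
Proof.
apply: measurable_fun_limn_esup => n; apply/measurable_EFinP.
apply: measurable_prod => i _; apply: (measurableT_comp mg (measurable_fun_pair _ _)).
  by apply: measurable_coord_upto; apply: grid_time_le => //; exact: ltnW.
by apply: measurable_coord_upto; exact: grid_time_le.
Qed.

End cylinders.

(** * Regular samples *)

Lemma nneseries_finite (R : realType) (f : nat -> \bar R) n :
  (forall k, 0 <= f k)%E -> (forall k, (n <= k)%N -> f k = 0%E) ->
  (\sum_(k <oo) f k = \sum_(k < n) f k)%E.
Proof.
move=> f0 fn; rewrite (nneseries_split 0 n)// add0n eseries0; last first.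
  by move=> i ni _; exact: fn.
by rewrite adde0 big_mkord.
Qed.

Section jump_process_paths.
Context {R : realType}.
Variable t : R.
Variables (y z : nat -> R) (x : {nonneg R} -> R).

(* The almost sure properties of a sample: z are the holding times, y the
   successive states, and x the path they build. *)
Definition regular_sample : Prop :=
  [/\ forall k, 0 < z k, exists n, t < seq_run z n &
      forall n (s : {nonneg R}),
        seq_run z n <= s%:num < seq_run z n.+1 -> x s = y n].

Definition jump_count (n : nat) : Prop := seq_run z n <= t < seq_run z n.+1.

Hypothesis t0 : 0 <= t.
Hypothesis reg : regular_sample.

Lemma jump_count_ex : exists n, jump_count n.
Proof.
have [z0 [n tn] _] := reg.
by have [j _ jt] := jump_index t0 tn; exists j.
Qed.

Lemma jump_count_le n k : jump_count n -> (seq_run z k <= t) = (k <= n)%N.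
Proof.
have [z0 _ _] := reg; move=> /andP[n1 n2]; apply/idP/idP => [kt|kn].
  exact: (jump_index_mono z0 (lexx t)).
exact: le_trans (seq_run_le z0 kn) n1.
Qed.

Lemma jump_count_uniq n k : jump_count n -> jump_count k -> n = k.
Proof.
move=> jn jk; have /andP[n1 _] := jn; have /andP[k1 _] := jk.
apply/eqP; rewrite eqn_leq -(jump_count_le _ jk) n1.
by rewrite -(jump_count_le _ jn) k1.
Qed.

(** The event that exactly n jumps occur up to t and that the path lies in the cylinder, expressed
    through n.+1 states and holding times so that [joint_density] applies to it. *)
Definition cylinder_event m (s : nat -> {nonneg R}) (B : nat -> set R) (n : nat)
    : set (seqT R n.+1 * seqT R n.+1) :=
  [set u | seq_run u.2 n <= t < seq_run u.2 n.+1] `&`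
  \bigcap_(i < m) \bigcup_(j < n.+1)
    ([set u | seq_run u.2 j <= (s i)%:num < seq_run u.2 j.+1] `&`
     [set u | B i (u.1 j)]).

Arguments cylinder_event : clear implicits.

Lemma cylinder_eventP m s B n : (forall i, (s i)%:num <= t) -> jump_count n ->
  cylinder_event m s B n (y, z) <-> (forall i, (i < m)%N -> B i (x (s i))).
Proof.
have [z0 _ xy] := reg; move=> st jn; have /andP[n1 n2] := jn; split.
  by move=> [_ H] i im; have [j jn' [/= sj By]] := H i im; rewrite (xy _ _ sj).
move=> Bx; split => // i im /=.
have si := le_lt_trans (st i) n2.
have si0 : 0 <= (s i)%:num by [].
have [j jn' sj] := jump_index si0 si.
by exists j => //=; split => //=; rewrite -(xy _ _ sj); exact: Bx.
Qed.

End jump_process_paths.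
Arguments cylinder_event {R}.

Section measurable_cylinder_event.
Context {R : realType}.

Lemma measurable_le_lt_seq_run (s : R) j n : (j < n)%N ->
  measurable [set u : seqT R n * seqT R n | seq_run u.2 j <= s < seq_run u.2 j.+1].
Proof.
move=> jn.
have m i : (i <= n)%N ->
    measurable_fun setT (fun u : seqT R n * seqT R n => seq_run u.2 i).
  by move=> ni; exact: (measurableT_comp (measurable_seq_run ni) measurable_snd).
rewrite (_ : [set _ | _] =
  (fun u : seqT R n * seqT R n => seq_run u.2 j) @^-1` `]-oo, s] `&`
  (fun u : seqT R n * seqT R n => seq_run u.2 j.+1) @^-1` `]s, +oo[).
  by apply: measurableI; rewrite -[X in measurable X]setTI; apply: m => //; exact: ltnW.
apply/seteqP; split => u /=; rewrite !in_itv/= andbT.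
  by move=> /andP.
by move=> [-> ->].
Qed.

Lemma measurable_cylinder_event t m s (B : nat -> set R) n :
  (forall i, measurable (B i)) -> measurable (cylinder_event t m s B n).
Proof.
move=> mB; apply: measurableI; first exact: measurable_le_lt_seq_run.
apply: bigcap_measurableType => i _; apply: bigcup_measurable => j jn.
apply: measurableI; first exact: measurable_le_lt_seq_run.
rewrite -[X in measurable X]setTI.
exact: (measurableT_comp (measurable_seq_coord _ _ jn) measurable_fst).
Qed.

End measurable_cylinder_event.

Section jump_process.
Context d (T : measurableType d) (R : realType) (Pr : probability T R).
Variables (Y tau : nat -> {RV Pr >-> R}) (X : {mfun T >-> pathT R}).
Variable t : R.
Hypothesis t0 : 0 <= t.
Hypothesis hold : holding_times Y tau.
Hypothesis path : {ae Pr, forall w, forall (n : nat) (s : {nonneg R}),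
  \sum_(k < n) tau k w <= s%:num < \sum_(k < n.+1) tau k w ->
  (X w : cadlag_path R) s = Y n w}.

Lemma regular_sample_ae : {ae Pr, forall w,
  regular_sample t (path_of Y w) (path_of tau w) (X w : cadlag_path R)}.
Proof.
have h1 := holding_times_gt0 hold.
have h2 := finitely_many_jumps hold t0.
by apply: filterS3 h1 h2 path => w ? ? ?; split.
Qed.

End jump_process.

Section path_density_properties.
Context {R : realType}.
Variables (t : R) (g : R -> R -> R).
Hypothesis t0 : 0 <= t.

Lemma path_density_ge0 (w : pathT_upto t) : (forall x y, 0 <= g x y) ->
  (0 <= path_density g w)%E.
Proof.
move=> g0; rewrite /path_density limn_esup_lim; apply: lime_ge.
  exact: is_cvg_esups.
apply: nearW => n; apply: (@le_trans _ _ (grid_ratio g t n (w : cadlag_path R))%:E).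
  by rewrite lee_fin; apply: prodr_ge0.
by apply: ereal_sup_ubound; exists n => /=.
Qed.

Lemma path_density_regular (x : pathT_upto t) (y z : nat -> R) n :
  (forall x, g x x = 1) ->
  regular_sample t y z (x : cadlag_path R) -> jump_count t z n ->
  path_density g x = (path_ratio g n y)%:E.
Proof.
move=> g1 [z0 _ xy] jn.
have h := near_grid_ratio g1 t0 z0 xy jn.
have /cvg_limn_einf_sup[_ //] :
    (grid_ratio g t n (x : cadlag_path R))%:E @[n --> \oo] --> (path_ratio g n y)%:E.
by apply: cvg_near_cst; apply: filterS h => k ->.
Qed.

(** Only the term whose index is the actual number of jumps survives. The coefficients [c] will be 1
    for one process and the path ratios for the other. *)
Lemma sum_cylinder_event (x : pathT_upto t) (y z : nat -> R) n m s B (c : nat -> R) :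
  regular_sample t y z (x : cadlag_path R) -> jump_count t z n ->
  (forall i, (s i)%:num <= t) -> (forall n, 0 <= c n) ->
  (\sum_(k <oo) ((\1_(cylinder_event t m s B k) (y, z) : R) * c k)%:E =
   ((\1_(cylinder m s B) (x : cadlag_path R) : R) * c n)%:E)%E.
Proof.
move=> reg jn st c0.
have mn k : cylinder_event t m s B k (y, z) -> k = n.
  by move=> [/= jk _]; exact: (jump_count_uniq reg jk jn).
rewrite (nneseries_finite (n := n.+1)); last 2 first.
- by move=> k; rewrite lee_fin mulr_ge0.
- move=> k nk; rewrite indicE memNset ?mul0r// => /mn kn.
  by move: nk; rewrite kn ltnn.
rewrite big_ord_recr/= big1 ?add0e; last first.
  move=> i _; rewrite indicE memNset ?mul0r// => /mn in_.
  by have := ltn_ord i; rewrite in_ ltnn.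
congr ((_ * _)%:E); rewrite !indicE; congr ((nat_of_bool _)%:R).
by apply/idP/idP; rewrite !inE => /(cylinder_eventP reg m B st jn).
Qed.

End path_density_properties.

(** * Density of one path law with respect to the other up to time t *)

Section jump_process_density.
Context d1 d2 (T1 : measurableType d1) (T2 : measurableType d2) (R : realType).
Variables (Pr1 : probability T1 R) (Pr2 : probability T2 R).
Variables (Y1 tau1 : nat -> {RV Pr1 >-> R}) (Y2 tau2 : nat -> {RV Pr2 >-> R}).
Variables (X1 : {mfun T1 >-> pathT R}) (X2 : {mfun T2 >-> pathT R}).
Variables (mu : set R -> \bar R) (K1 K2 : R -> set R -> \bar R).
Variables (k g : R -> R -> R) (t : R).
Hypothesis t0 : 0 <= t.
Hypothesis chainY1 : markov_chain mu K1 Y1.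
Hypothesis chainY2 : markov_chain mu K2 Y2.
Hypothesis hold1 : holding_times Y1 tau1.
Hypothesis hold2 : holding_times Y2 tau2.
Hypothesis reg1 : {ae Pr1, forall w,
  regular_sample t (path_of Y1 w) (path_of tau1 w) (X1 w : cadlag_path R)}.
Hypothesis reg2 : {ae Pr2, forall w,
  regular_sample t (path_of Y2 w) (path_of tau2 w) (X2 w : cadlag_path R)}.
Hypothesis K1E : forall x B, x \in `[0, 1] -> measurable B ->
  K1 x B = (\int[lebesgue_measure]_(y in B) (k x y)%:E)%E.
Hypothesis K2E : forall x B, x \in `[0, 1] -> measurable B ->
  K2 x B = (\int[lebesgue_measure]_(y in B) (k x y * g x y)%:E)%E.
Hypothesis mk : measurable_fun setT (fun u : R * R => k u.1 u.2).
Hypothesis k0 : forall x y, 0 <= k x y.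
Hypothesis mg : measurable_fun setT (fun u : R * R => g u.1 u.2).
Hypothesis g0 : forall x y, 0 <= g x y.
Hypothesis g1 : forall x, g x x = 1.
Local Open Scope ereal_scope.

Let Z1 w : pathT_upto t := to_upto t (X1 w).
Let Z2 w : pathT_upto t := to_upto t (X2 w).

Let mZ1 : measurable_fun setT Z1.
Proof. exact: measurableT_comp. Qed.

Let mZ2 : measurable_fun setT Z2.
Proof. exact: measurableT_comp. Qed.

(** A real-valued version of the density along the sample, as weighted images require; the two agree
    almost surely, the density being finite on regular samples. *)
Let weight w : R := fine (path_density g (Z1 w)).

Let mweight : measurable_fun setT weight.
Proof.
apply: measurableT_comp => //; apply: measurableT_comp => //.
exact: measurable_path_density.
Qed.

Let weight0 w : (0 <= weight w)%R.
Proof. by apply: fine_ge0; exact: path_density_ge0. Qed.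

(** Both integrals are split according to the number n of jumps. On each piece [joint_density]
    transfers the event, with ratio [path_ratio g n], and on that piece this ratio is the path
    density. *)
Let weight_cylinder m s (B : nat -> set R) :
  (forall i, (s i)%:num <= t)%R -> (forall i, measurable (B i)) ->
  \int[Pr2]_(w in Z2 @^-1` cylinder m s B) (cst 1%R w)%:E =
  \int[Pr1]_(w in Z1 @^-1` cylinder m s B) (weight w)%:E.
Proof.
move=> st mB; set A : set (pathT_upto t) := cylinder m s B.
have mA : measurable A.
  rewrite measurable_upto_cylinders//; apply: sub_sigma_algebra.
  by exists m, s, B.
pose F n := cylinder_event t m s B n.
have mF n : measurable (F n) by exact: measurable_cylinder_event.
have mind d (T : measurableType d) (U : T -> pathT_upto t) :
    measurable_fun setT U -> measurable_fun setT (fun w => \1_A (U w) : R).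
  by move=> mU; exact: (measurableT_comp (measurable_indic mA)).
have mF_ind n d (T : measurableType d) (P : probability T R)
    (Y tau : nat -> {RV P >-> R}) :
    measurable_fun setT (fun w => (\1_(F n) (path_of Y w, path_of tau w) : R)).
  apply: (measurableT_comp (measurable_indic (mF n)) (measurable_fun_pair _ _));
    exact: measurable_path_of.
transitivity (\int[Pr2]_w ((\1_A (Z2 w) : R) * cst 1%R w)%:E).
  rewrite integral_mkcond; apply: eq_integral => w _.
  rewrite patchE indicE mulr1.
  have -> : (w \in Z2 @^-1` A) = (Z2 w \in A) by apply/idP/idP; rewrite !inE.
  by case: ifPn.
transitivity (\int[Pr2]_w \sum_(n <oo)
    ((\1_(F n) (path_of Y2 w, path_of tau2 w) : R) * 1)%:E).
  apply: ge0_ae_eq_integral => //.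
  - by apply/measurable_EFinP; apply: measurable_funM => //; exact: mind.
  - apply: ge0_emeasurable_sum.
      by move=> n w _ _; rewrite lee_fin mulr_ge0.
    move=> n _; apply/measurable_EFinP; apply: measurable_funM => //.
  - by move=> w _; rewrite lee_fin mulr1.
  - by move=> w _; apply: nneseries_ge0 => n _ _; rewrite lee_fin mulr1.
  - apply: filterS reg2 => w regw _.
    have [n jn] := jump_count_ex t0 regw.
    by rewrite (sum_cylinder_event (c := fun=> 1%R) m B regw jn st).
rewrite integral_nneseries//; last first.
  by move=> n; apply/measurable_EFinP; apply: measurable_funM.
transitivity (\sum_(n <oo) \int[Pr1]_w
  ((\1_(F n) (path_of Y1 w, path_of tau1 w) : R) * path_ratio g n (path_of Y1 w))%:E).
  apply: eq_eseriesr => n _.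
  under eq_integral do rewrite mulr1.
  rewrite (joint_density chainY1 chainY2 hold1 hold2 K1E K2E mk k0 mg g0
    (f := fun u => (\1_(F n) u : R)%:E))//.
  by apply/measurable_EFinP; exact: measurable_indic.
rewrite -integral_nneseries//; last 2 first.
- move=> n; apply/measurable_EFinP; apply: measurable_funM => //.
  exact: (measurableT_comp (measurable_path_ratio mg (ltnSn n))
    (measurable_path_of _ _)).
- by move=> n w _; rewrite lee_fin mulr_ge0// path_ratio_ge0.
transitivity (\int[Pr1]_w ((\1_A (Z1 w) : R) * weight w)%:E); last first.
  rewrite [RHS]integral_mkcond; apply: eq_integral => w _.
  rewrite patchE indicE.
  have -> : (w \in Z1 @^-1` A) = (Z1 w \in A) by apply/idP/idP; rewrite !inE.
  by case: ifPn; rewrite ?mul1r ?mul0r.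
apply: ge0_ae_eq_integral => //.
- apply: ge0_emeasurable_sum.
    by move=> n w _ _; rewrite lee_fin mulr_ge0// path_ratio_ge0.
  move=> n _; apply/measurable_EFinP; apply: measurable_funM => //.
  exact: (measurableT_comp (measurable_path_ratio mg (ltnSn n))
    (measurable_path_of _ _)).
- by apply/measurable_EFinP; apply: measurable_funM => //; exact: mind.
- move=> w _; apply: nneseries_ge0 => n _ _.
  by rewrite lee_fin mulr_ge0// path_ratio_ge0.
- by move=> w _; rewrite lee_fin mulr_ge0.
- apply: filterS reg1 => w regw _.
  have [n jn] := jump_count_ex t0 regw.
  rewrite (sum_cylinder_event (c := path_ratio g ^~ (path_of Y1 w)) m B regw jn st)//.
    by congr ((_ * _)%:E); rewrite /weight (path_density_regular t0 g1 regw jn).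
  by move=> i; exact: path_ratio_ge0.
Qed.

Let integral_image (f : pathT_upto t -> \bar R) :
  measurable_fun setT f -> (forall u, 0 <= f u) ->
  \int[Pr2]_w f (Z2 w) = \int[Pr1]_w (f (Z1 w) * path_density g (Z1 w)).
Proof.
move=> mf f0.
have -> : \int[Pr2]_w f (Z2 w) = \int[Pr2]_w (f (Z2 w) * (cst 1%R w)%:E).
  by apply: eq_integral => w _; rewrite mule1.
rewrite (@eq_weighted_integral _ _ _ _ _ (pathT_upto t) _ _ Pr1 _ Z1 _ weight
  (cylinders t))//.
- apply: ge0_ae_eq_integral => //.
  + by apply: emeasurable_funM; [exact: measurableT_comp|exact/measurable_EFinP].
  + apply: emeasurable_funM; first exact: measurableT_comp.
    by apply: measurableT_comp => //; exact: measurable_path_density.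
  + by move=> w _; rewrite mule_ge0// lee_fin.
  + by move=> w _; rewrite mule_ge0// path_density_ge0.
  + apply: filterS reg1 => w regw _.
    have [n jn] := jump_count_ex t0 regw.
    by congr (_ * _); rewrite /weight (path_density_regular t0 g1 regw jn).
- exact: measurable_upto_cylinders.
- exact: cylindersI.
- exact: cylindersT.
- by rewrite probability_integral_cst1// probability_setT ltry.
- by move=> _ [m [s [B [st mB ->]]]]; exact: weight_cylinder.
Qed.

Variables (Q1 Q2 : probability (pathT R) R).
Hypothesis Q1E : forall A, measurable A -> Q1 A = distribution Pr1 X1 A.
Hypothesis Q2E : forall A, measurable A -> Q2 A = distribution Pr2 X2 A.

(** [integral_image] at the indicator of A, read through the images of the sample spaces. It makes
    the grid limit an explicit version of the Radon-Nikodym derivative. *)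
Lemma restr_upto_density A : measurable A ->
  restr_upto Q2 t A = \int[restr_upto Q1 t]_(w in A) path_density g w.
Proof.
move=> mA; have mpre : measurable (to_upto t @^-1` A).
  by rewrite -[X in measurable X]setTI; exact: measurable_to_upto.
have mD := measurable_path_density t0 mg.
have D0 w : 0 <= path_density g (w : pathT_upto t) by exact: path_density_ge0.
rewrite /restr_upto [RHS]ge0_integral_pushforward//=; last exact: measurable_funTS.
rewrite (eq_measure_integral (distribution Pr1 X1)); last first.
  by move=> B mB _; exact: Q1E.
rewrite ge0_integral_pushforward//=; last first.
  by apply: measurable_funTS; exact: measurableT_comp.
transitivity (\int[Pr2]_w (\1_A (Z2 w) : R)%:E).
  rewrite [LHS](Q2E mpre).
  rewrite (_ : (fun w => _) = fun w => (\1_(Z2 @^-1` A) w : R)%:E)//.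
  rewrite integral_indic ?setIT//.
  by rewrite -[X in measurable X]setTI; exact: mZ2.
rewrite (integral_image (f := fun u => (\1_A u : R)%:E))//.
- rewrite [RHS]integral_mkcond; apply: eq_integral => w _.
  rewrite patchE indicE.
  have -> : (w \in X1 @^-1` (to_upto t @^-1` A)) = (Z1 w \in A).
    by apply/idP/idP; rewrite !inE.
  by case: ifPn; rewrite ?mul1e ?mul0e.
- by apply/measurable_EFinP; exact: measurable_indic.
Qed.

End jump_process_density.

(** * Expected logarithm of the density *)

Section jump_sums.
Context d (T : measurableType d) (R : realType) (Pr : probability T R).
Variables (Y tau : nat -> {RV Pr >-> R}).
Variable t : R.
Hypothesis t0 : 0 <= t.
Hypothesis hold : holding_times Y tau.
Local Open Scope ereal_scope.

(** The jump from [y i] to [y i.+1] happens at time [seq_run z i.+1], whence the shifted index in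
    the indicator. *)
Definition jump_sum (h : R -> R -> R) (y z : nat -> R) : \bar R :=
  \sum_(i <oo) ((\1_[set z | seq_run z i.+1 <= t]%R z : R) * h (y i) (y i.+1))%:E.

Let mle i n : (i <= n)%N -> measurable [set z : seqT R n | seq_run z i <= t]%R.
Proof.
move=> ni; rewrite (_ : [set _ | _] = (fun z : seqT R n => seq_run z i) @^-1` `]-oo, t]).
  by rewrite -[X in measurable X]setTI; exact: measurable_seq_run.
by apply/seteqP; split => z /=; rewrite in_itv.
Qed.

Variables (h : R -> R -> R) (c : R).
Hypothesis mh : measurable_fun setT (fun u : R * R => h u.1 u.2).
Hypothesis h0 : forall x y, (0 <= h x y)%R.
Hypothesis hc : forall i, \int[Pr]_w (h (Y i w) (Y i.+1 w))%:E = c%:E.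

Let term i (u : seqT R i.+2 * seqT R i.+2) : \bar R :=
  ((\1_[set z | seq_run z i.+1 <= t]%R u.2 : R) * h (u.1 i) (u.1 i.+1))%:E.

Let mterm i : measurable_fun setT (@term i).
Proof.
apply/measurable_EFinP; apply: measurable_funM.
  exact: (measurableT_comp (measurable_indic (mle (ltnW (ltnSn _)))) measurable_snd).
apply: (measurableT_comp (measurable_seq_pair mh (ltnSn _)) measurable_fst).
Qed.

Let term0 i u : 0 <= @term i u.
Proof. by rewrite lee_fin mulr_ge0. Qed.

Let mterm_path i : measurable_fun setT (fun w => @term i (path_of Y w, path_of tau w)).
Proof.
apply: (measurableT_comp (@mterm i) (measurable_fun_pair _ _)) => //;
  exact: measurable_path_of.
Qed.

Lemma measurable_jump_sum :
  measurable_fun setT (fun w => jump_sum h (path_of Y w) (path_of tau w)).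
Proof.
apply: ge0_emeasurable_sum.
  by move=> i w _ _; exact: (@term0 i (path_of Y w, path_of tau w)).
by move=> i _; exact: mterm_path.
Qed.

Lemma jump_sum_ge0 (y z : nat -> R) : 0 <= jump_sum h y z.
Proof. by apply: nneseries_ge0 => i _ _; exact: (@term0 i (y, z)). Qed.

(** A form of Wald's identity: states and holding times being independent, term i has mean c times
    the probability that jump i.+1 occurs up to t, and these probabilities sum to t. *)
Lemma integral_jump_sum :
  \int[Pr]_w jump_sum h (path_of Y w) (path_of tau w) = (t * c)%:E.
Proof.
have c0 : 0 <= c%:E.
  by rewrite -(hc 0); apply: integral_ge0 => w _; rewrite lee_fin.
rewrite integral_nneseries//; last first.
  by move=> i w _; exact: (@term0 i (path_of Y w, path_of tau w)).
transitivity (\sum_(i <oo) (c%:E * Pr [set w | seq_run (path_of tau w) i.+1 <= t]%R)).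
  apply: eq_eseriesr => i _.
  rewrite [LHS](@independent_ge0_integral _ _ _ _ _ _ hold i.+2 (@term i))//.
  have mset : measurable [set v | seq_run (path_of tau v) i.+1 <= t]%R.
    rewrite (_ : [set _ | _] =
        (fun w => seq_run (path_of tau w) i.+1) @^-1` `]-oo, t]).
      by rewrite -[X in measurable X]setTI; exact: (measurable_jump_time tau i.+1).
    by apply/seteqP; split => v /=; rewrite in_itv.
  transitivity (\int[Pr]_w ((h (Y i w) (Y i.+1 w))%:E *
      Pr [set w | seq_run (path_of tau w) i.+1 <= t]%R)).
    apply: eq_integral => w _; rewrite /term /=.
    rewrite -[in RHS](setIT [set v | _]) -integral_indic//.
    rewrite -ge0_integralZl ?lee_fin//.
    + by apply: eq_integral => v _; rewrite -EFinM mulrC.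
    + by apply/measurable_EFinP; exact: measurable_indic.
  rewrite ge0_integralZr ?hc//.
  - apply/measurable_EFinP; apply: (measurableT_comp mh (measurable_fun_pair _ _));
      exact: measurable_funPT.
  - by move=> w _; rewrite lee_fin.
rewrite nneseriesZl//.
by rewrite (expected_number_of_jumps hold t0) -EFinM mulrC.
Qed.

Lemma integrable_jump_sum :
  Pr.-integrable setT (fun w => jump_sum h (path_of Y w) (path_of tau w)).
Proof.
apply/integrableP; split; first exact: measurable_jump_sum.
under eq_integral do rewrite gee0_abs ?jump_sum_ge0//.
by rewrite integral_jump_sum ltry.
Qed.

End jump_sums.

Lemma jump_sum_regular (R : realType) (t : R) (h : R -> R -> R) (y z : nat -> R)
    (x : {nonneg R} -> R) n :
  0 <= t -> (forall x y, 0 <= h x y) -> regular_sample t y z x ->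
  jump_count t z n ->
  jump_sum t h y z = (\sum_(i < n) h (y i) (y i.+1))%:E.
Proof.
move=> t0 h0 reg jn; rewrite /jump_sum (nneseries_finite (n := n)).
- rewrite -sumEFin; apply: eq_bigr => i _.
  by rewrite indicE mem_set ?mul1r//= (jump_count_le reg _ jn).
- by move=> i; rewrite lee_fin mulr_ge0.
- move=> i ni; rewrite indicE memNset ?mul0r//= (jump_count_le reg _ jn).
  by rewrite ltnNge ni.
Qed.

Lemma ln_path_ratio (R : realType) (g : R -> R -> R) n (y : nat -> R) :
  (forall x y, 0 < g x y) ->
  ln (path_ratio g n y) = \sum_(i < n) ln (g (y i) (y i.+1)).
Proof.
move=> g0; elim: n => [|n IH]; first by rewrite /path_ratio !big_ord0 ln1.
by rewrite path_ratioS lnM ?big_ord_recr/= ?IH// posrE// /path_ratio prodr_gt0.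
Qed.

(** On finite values [lne] is the real logarithm, extended by -oo at nonpositive arguments. The
    Radon-Nikodym derivative meets the finiteness condition everywhere. *)
Lemma measurable_lne_fin d (T : measurableType d) (R : realType) (f : T -> \bar R) :
  measurable_fun setT f -> (forall x, f x \is a fin_num) ->
  measurable_fun setT (fun x => lne (f x)).
Proof.
move=> mf ffin.
have mr : measurable_fun setT (fun x => fine (f x)) by exact: measurableT_comp.
rewrite (_ : (fun x => _) = fun x =>
  if fine (f x) <= 0 then -oo%E else (ln (fine (f x)))%:E).
  apply: measurable_fun_ifT => //.
    exact: measurable_fun_ler.
  by apply/measurable_EFinP; exact: measurableT_comp.
by apply/funext => x; rewrite -[in LHS](fineK (ffin x)).
Qed.

(** Positive and negative parts are transported separately, so the logarithm of the density can be
    pulled back before its integrability is known. *)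
Lemma integral_pushforward_measurable d1 d2 (X : measurableType d1)
    (Y : measurableType d2) (R : realType) (mu : {measure set X -> \bar R})
    (phi : {mfun X >-> Y}) (f : Y -> \bar R) : measurable_fun setT f ->
  (\int[pushforward mu phi]_y f y = \int[mu]_x f (phi x))%E.
Proof.
move=> mf; rewrite [LHS]integralE [RHS]integralE; congr (_ - _)%E.
- rewrite ge0_integral_pushforward ?preimage_setT//.
    by apply: eq_integral => x _; rewrite /= ?funeposE ?funenegE.
  exact: measurable_funepos.
- rewrite ge0_integral_pushforward ?preimage_setT//.
    by apply: eq_integral => x _; rewrite /= ?funeposE ?funenegE.
  exact: measurable_funeneg.
Qed.

Section expected_log_density.
Context d (T : measurableType d) (R : realType) (Pr : probability T R).
Variables (Y tau : nat -> {RV Pr >-> R}) (X : {mfun T >-> pathT R}).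
Variables (t : R) (g : R -> R -> R) (M c : R).
Hypothesis t0 : 0 <= t.
Hypothesis hold : holding_times Y tau.
Hypothesis reg : {ae Pr, forall w,
  regular_sample t (path_of Y w) (path_of tau w) (X w : cadlag_path R)}.
Hypothesis mg : measurable_fun setT (fun u : R * R => g u.1 u.2).
Hypothesis g0 : forall x y, 0 < g x y.
Hypothesis g1 : forall x, g x x = 1.
Hypothesis M0 : 0 <= M.
Hypothesis gM : forall x y, 0 <= ln (g x y) + M.
Hypothesis gc : forall i,
  (\int[Pr]_w (ln (g (Y i w) (Y i.+1 w)) + M)%:E = c%:E)%E.
Local Open Scope ereal_scope.

(** Almost surely the logarithm is [U] - [V], where [U] sums ln g + M and [V] sums M over the jumps.
    Both are nonnegative with finite means t c and t M, so the difference of the integrals makes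
    sense. *)
Lemma expected_ln_density (f : pathT_upto t -> \bar R) :
  measurable_fun setT f -> (forall w, f w \is a fin_num) ->
  {ae Pr, forall w, f (to_upto t (X w)) = path_density g (to_upto t (X w))} ->
  \int[Pr]_w lne (f (to_upto t (X w))) = (t * (c - M))%:E.
Proof.
move=> mf ffin fD.
pose h x y := (ln (g x y) + M)%R.
have mh : measurable_fun setT (fun u : R * R => h u.1 u.2).
  by apply: measurable_funD => //; exact: measurableT_comp.
pose U w := jump_sum t h (path_of Y w) (path_of tau w).
pose V w := jump_sum t (fun _ _ => M) (path_of Y w) (path_of tau w).
have McE i : \int[Pr]_w ((fun _ _ => M) (Y i w) (Y i.+1 w))%:E = M%:E.
  by rewrite (eq_integral (cst M%:E))// integral_cst//
    [X in _ * X]probability_setT mule1.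
have mM : measurable_fun setT (fun u : R * R => M) by [].
have iU : Pr.-integrable setT U by exact: (integrable_jump_sum t0 hold mh gM gc).
have iV : Pr.-integrable setT V.
  exact: (integrable_jump_sum t0 hold mM (fun _ _ => M0) McE).
transitivity (\int[Pr]_w (U \- V) w).
  apply: ae_eq_integral => //.
  - apply: (measurable_lne_fin (f := fun w => f (to_upto t (X w)))) => //.
    by apply: measurableT_comp => //; exact: measurableT_comp.
  - apply: emeasurable_funB; first exact: (measurable_int Pr iU).
    exact: (measurable_int Pr iV).
  - apply: filterS2 reg fD => w regw -> _.
    have [n jn] := jump_count_ex t0 regw.
    rewrite (path_density_regular t0 g1 regw jn) lne_EFin; last first.
      by rewrite /path_ratio prodr_gt0.
    rewrite /= /U /V (jump_sum_regular t0 gM regw jn).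
    rewrite (jump_sum_regular t0 (fun _ _ => M0) regw jn).
    by rewrite -EFinB ln_path_ratio// big_split/= addrK.
rewrite integralB// (integral_jump_sum t0 hold mh gM gc).
rewrite (integral_jump_sum t0 hold mM (fun _ _ => M0) McE) -EFinB.
by congr (_%:E); rewrite mulrBr.
Qed.

End expected_log_density.

(** * Relative entropy of two jump process laws at a finite time *)

Section relative_entropy.
Context {R : realType}.
Variables (Q1 Q2 : probability (pathT R) R).
Variables (mu : set R -> \bar R) (K1 K2 : R -> set R -> \bar R).
Variables (theta : R -> R) (k g : R -> R -> R) (M : R).
Hypothesis law1 : jump_process_law mu K1 Q1.
Hypothesis law2 : jump_process_law mu K2 Q2.
Hypothesis muE : forall B, measurable B ->
  mu B = (\int[lebesgue_measure]_(y in B) (theta y)%:E)%E.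
Hypothesis K1E : forall x B, x \in `[0, 1] -> measurable B ->
  K1 x B = (\int[lebesgue_measure]_(y in B) (k x y)%:E)%E.
Hypothesis K2E : forall x B, x \in `[0, 1] -> measurable B ->
  K2 x B = (\int[lebesgue_measure]_(y in B) (k x y * g x y)%:E)%E.
Hypothesis mtheta : measurable_fun setT theta.
Hypothesis theta0 : forall x, 0 <= theta x.
Hypothesis mk : measurable_fun setT (fun u : R * R => k u.1 u.2).
Hypothesis k0 : forall x y, 0 <= k x y.
Hypothesis mg : measurable_fun setT (fun u : R * R => g u.1 u.2).
Hypothesis g0 : forall x y, 0 < g x y.
Hypothesis g1 : forall x, g x x = 1.
Hypothesis M0 : 0 <= M.
Hypothesis gM : forall x y, `|ln (g x y)| <= M.
Local Open Scope ereal_scope.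
Hypothesis invariant : forall y,
  \int[lebesgue_measure]_x (theta x * (k x y * g x y))%:E = (theta y)%:E.

(* Shifting by M keeps all integrands nonnegative. *)
Definition log_ratio_mean : \bar R :=
  \int[lebesgue_measure]_x \int[lebesgue_measure]_y
    ((ln (g x y) + M)%:E * (theta x * (k x y * g x y))%:E).

(** The logarithm is integrated under [Q2], so the invariant density is that of the kernel k g.
    Stationarity gives every jump the same mean of ln g, which makes the entropy linear in t. *)
Lemma jump_process_rel_entropy (t : R) : (0 <= t)%R ->
  restr_upto Q2 t `<< restr_upto Q1 t /\
  rel_entropy Q2 Q1 t = (- (t * (fine log_ratio_mean - M)))%:E.
Proof.
move=> t0.
have [d1 [T1 [Pr1 [Y1 [tau1 [X1 [chainY1 hold1 path1 Q1E]]]]]]] := law1.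
have [d2 [T2 [Pr2 [Y2 [tau2 [X2 [chainY2 hold2 path2 Q2E]]]]]]] := law2.
have reg1 := regular_sample_ae t0 hold1 path1.
have reg2 := regular_sample_ae t0 hold2 path2.
have g0' x y : (0 <= g x y)%R by exact: ltW.
have density := restr_upto_density t0 chainY1 chainY2 hold1 hold2 reg1 reg2
  K1E K2E mk k0 mg g0' g1 Q1E Q2E.
have mD := measurable_path_density t0 mg.
have dom : restr_upto Q2 t `<< restr_upto Q1 t.
  apply/null_content_dominatesP => A mA A0.
  by rewrite density// null_set_integral//; exact: measurable_funTS.
split => //.
pose f := Radon_Nikodym (charge_of_finite_measure (restr_upto Q2 t)) (restr_upto Q1 t).
have dom' : charge_of_finite_measure (restr_upto Q2 t) `<< restr_upto Q1 t.
  by [].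
have fint : (restr_upto Q1 t).-integrable setT f.
  exact: Radon_Nikodym_integrable.
have mf : measurable_fun setT f := measurable_int _ fint.
have ffin w : f w \is a fin_num by exact: Radon_Nikodym_fin_num.
(* Both functions have the integral [restr_upto Q2 t A] over each measurable A, hence agree outside
   a null set of the reference law. *)
have [N [mN N0 subN]] : ae_eq (restr_upto Q1 t) setT f
    (path_density g : pathT_upto t -> \bar R).
  apply: integral_ae_eq => // A _ mA.
  by rewrite -Radon_Nikodym_integral//= -density.
(* Absolute continuity makes the exceptional set null for [Q2] as well, and its preimage is then
   null in the second sample space. *)
have fD : {ae Pr2, forall w,
    f (to_upto t (X2 w)) = path_density g (to_upto t (X2 w))}.
  exists ((fun w => to_upto t (X2 w)) @^-1` N); split.
  - rewrite -[X in measurable X]setTI.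
    have mZ : measurable_fun setT (fun w => to_upto t (X2 w)).
      exact: measurableT_comp.
    exact: mZ.
  - have : restr_upto Q2 t N = 0.
      by move/null_content_dominatesP : dom; apply.
    rewrite [X in X = _ -> _](Q2E (to_upto t @^-1` N))//.
    by rewrite -[X in measurable X]setTI; exact: measurable_to_upto.
  - by move=> w /= nfD; apply: subN => /= h; apply: nfD; exact: h.
rewrite /rel_entropy -/f EFinN; congr (- _).
rewrite (eq_measure_integral (distribution Pr2 X2)); last first.
  by move=> B mB _; exact: Q2E.
rewrite integral_pushforward_measurable; last first.
  apply: (measurable_lne_fin (f := fun w => f (to_upto t w))) => //.
  exact: measurableT_comp.
pose k2 x y := (k x y * g x y)%R.
have mk2 : measurable_fun setT (fun u : R * R => k2 u.1 u.2).
  exact: measurable_funM.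
have k20 x y : (0 <= k2 x y)%R by rewrite mulr_ge0.
have K2E' : forall x B, x \in `[0%R, 1%R] -> measurable B ->
    K2 x B = \int[lebesgue_measure]_(y in B) (k2 x y)%:E by exact: K2E.
have gM0 x y : (0 <= ln (g x y) + M)%R.
  by have := gM x y; rewrite ler_norml => /andP[]; rewrite -lerBlDr sub0r.
have mh : measurable_fun setT (fun u : R * R => (ln (g u.1 u.2) + M)%:E).
  by apply/measurable_EFinP; apply: measurable_funD => //; exact: measurableT_comp.
have meanE i : \int[Pr2]_w (ln (g (Y2 i w) (Y2 i.+1 w)) + M)%:E = log_ratio_mean.
  by rewrite (stationary_pair_integral chainY2 K2E' mk2 k20 muE mtheta theta0
    invariant i (h := fun x y => (ln (g x y) + M)%:E)).
apply: (expected_ln_density t0 hold2 reg2 mg g0 g1 M0 gM0) => // i.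
rewrite meanE fineK// -(meanE 0%N) ge0_fin_numE; last first.
  by apply: integral_ge0 => w _; rewrite lee_fin.
(* The shifted logarithm is at most 2M, so its mean is finite and [fine] loses nothing. *)
apply: (@le_lt_trans _ _ (\int[Pr2]_w (cst (M + M)%:E w))); last first.
  by rewrite integral_cst// [X in _ * X]probability_setT mule1 ltry.
apply: ge0_le_integral => //.
- by move=> w _; rewrite lee_fin.
- apply: (measurableT_comp mh (measurable_fun_pair _ _)); exact: measurable_funPT.
- by move=> w _; rewrite lee_fin lerD2r (le_trans (ler_norm _)).
Qed.

End relative_entropy.

(** * Continuous functions on the unit square *)

Section clamp.
Context {R : realType}.

Definition clamp (x : R) : R := Num.max 0 (Num.min x 1).

Lemma clamp_itv x : clamp x \in `[0, 1].
Proof. by rewrite in_itv/= /clamp le_max lexx ge_max ler01 ge_min lexx orbT. Qed.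

Lemma clamp_id x : x \in `[0, 1] -> clamp x = x.
Proof. by rewrite in_itv/= /clamp => /andP[x0 x1]; rewrite min_l// max_r. Qed.

Lemma continuous_clamp : continuous clamp.
Proof.
move=> x; have -> : clamp = cst 0 \max (idfun \min cst 1) by [].
apply: (@continuous_max _ R); first exact: cvg_cst.
by apply: (@continuous_min _ R); [exact: cvg_id|exact: cvg_cst].
Qed.

Lemma continuous_comp_within (S T U : topologicalType) (A : set T) (f : T -> U)
    (h : S -> T) : {within A, continuous f} -> continuous h ->
  (forall x, A (h x)) -> continuous (f \o h).
Proof.
move=> /subspace_continuousP fA ch hA x.
apply: cvg_comp (fA _ (hA x)) => B wB.
apply: (@filterS _ (nbhs x) _ (h @^-1` [set y | A y -> B y])).
  by move=> z; apply; exact: hA.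
exact: ch.
Qed.

Lemma continuous_clamp_fun (f : R -> R) :
  {within `[0, 1], continuous f} -> continuous (f \o clamp).
Proof.
move=> cf; apply: (continuous_comp_within cf continuous_clamp) => x /=.
exact: clamp_itv.
Qed.

Lemma continuous_clamp_fun2 (f : R * R -> R) :
  {within `[0, 1] `*` `[0, 1], continuous f} ->
  continuous (fun u => f (clamp u.1, clamp u.2)).
Proof.
move=> cf.
apply: (continuous_comp_within (h := fun u : R * R => (clamp u.1, clamp u.2)) cf).
  move=> u.
  have h1 : clamp v.1 @[v --> u] --> clamp u.1.
    by apply: continuous_comp; [exact: cvg_fst|exact: continuous_clamp].
  have h2 : clamp v.2 @[v --> u] --> clamp u.2.
    by apply: continuous_comp; [exact: cvg_snd|exact: continuous_clamp].
  exact: cvg_pair h1 h2.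
by move=> x; split => /=; exact: clamp_itv.
Qed.

(* The function is measurable in its second variable and the limit of its
   discretizations in the first one. *)
Lemma measurable_clamp_fun2 (f : R * R -> R) :
  {within `[0, 1] `*` `[0, 1], continuous f} ->
  measurable_fun setT (fun u : R * R => f (clamp u.1, clamp u.2)).
Proof.
move=> cf; pose F (u : R * R) := f (clamp u.1, clamp u.2).
have cF : continuous F := continuous_clamp_fun2 cf.
pose r n (x : R) : R := (Num.truncn (n.+1%:R * clamp x))%:R / n.+1%:R.
have clamp0 x : 0 <= clamp x by have := clamp_itv x; rewrite in_itv => /andP[].
have r_clamp x : r n x @[n --> \oo] --> clamp x.
  have r_dist n : `|clamp x - r n x| <= n.+1%:R^-1.
    have n0 : 0 < n.+1%:R :> R by [].
    have nc0 : 0 <= n.+1%:R * clamp x by rewrite mulr_ge0.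
    have /andP[t1 t2] := truncn_itv nc0.
    have -> : clamp x - r n x =
        (n.+1%:R * clamp x - (Num.truncn (n.+1%:R * clamp x))%:R) / n.+1%:R.
      by rewrite /r; field.
    rewrite ger0_norm ?divr_ge0 ?subr_ge0// -[leRHS]mul1r ler_wpM2r ?invr_ge0//.
    by rewrite lerBlDl natr1 ltW.
  apply/cvgrPdist_lt => e e0; near=> n.
  apply: le_lt_trans (r_dist n) _; near: n.
  exact: (near_infty_natSinv_lt (PosNum e0)).
apply/measurable_EFinP.
apply: (emeasurable_fun_cvg (fun n (u : R * R) => (F (r n u.1, u.2))%:E)).
- move=> n; apply/measurable_EFinP => _ B mB; rewrite setTI.
  rewrite (_ : _ @^-1` _ = \bigcup_k
    ([set x : R | Num.truncn (n.+1%:R * clamp x) = k] `*`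
     [set y : R | B (F (k%:R / n.+1%:R, y))])); last first.
    apply/seteqP; split => [[x y] /= Bxy|[x y] [k _ [/= xk]]].
      by exists (Num.truncn (n.+1%:R * clamp x)).
    by rewrite /r xk.
  apply: bigcupT_measurable => k; apply: measurableX.
    rewrite (_ : [set _ | _] =
      (fun x => n.+1%:R * clamp x) @^-1` `[k%:R, k.+1%:R[); last first.
      by apply/seteqP; split => x /=; rewrite in_itv/= -truncn_eq ?mulr_ge0// => /eqP.
    rewrite -[X in measurable X]setTI; apply: continuous_measurable_fun => // x.
    by apply: cvgM; [exact: cvg_cst|exact: continuous_clamp].
  rewrite -[X in measurable X]setTI.
  have c2 : continuous (fun y => F (k%:R / n.+1%:R, y)).
    move=> y.
    have h1 : k%:R / n.+1%:R @[v --> y] --> (k%:R / n.+1%:R : R) by exact: cvg_cst.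
    have h2 : v @[v --> y] --> y by exact: cvg_id.
    exact: cvg_comp (cvg_pair h1 h2) (cF (k%:R / n.+1%:R, y)).
  exact: (continuous_measurable_fun c2).
- move=> u _.
  suff : (F (r n u.1, u.2))%:E @[n --> \oo] --> (F (clamp u.1, u.2))%:E.
    by rewrite [in X in _ --> X]/F /= (clamp_id (clamp_itv u.1)).
  apply: cvg_EFin; first exact: nearW.
  have h2 : u.2 @[n --> \oo] --> u.2 by exact: cvg_cst.
  exact: cvg_comp (cvg_pair (r_clamp u.1) h2) (cF (clamp u.1, u.2)).
Unshelve. all: by end_near. Qed.

Lemma clamp_fun_ln_bounded (f : R -> R) :
  {within `[0, 1], continuous f} -> (forall x, x \in `[0, 1] -> 0 < f x) ->
  exists2 M, 0 <= M & forall x, `|ln (f (clamp x))| <= M.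
Proof.
move=> cf f0.
have cl : continuous (fun x => ln (f (clamp x))).
  move=> x; apply: continuous_comp; first exact: continuous_clamp_fun cf x.
  by apply: continuous_ln; rewrite f0// clamp_itv.
have comp : compact ((fun x => ln (f (clamp x))) @` `[0, 1]).
  apply: continuous_compact; last exact: segment_compact.
  exact: continuous_subspaceT.
have [M [_ HM]] := compact_bounded comp.
(* Boundedness only provides bounds strictly above a threshold M of unknown sign; |M| + 1 is above
   it and nonnegative. *)
exists (`|M| + 1) => [|x]; first by rewrite addr_ge0.
apply: HM; first by rewrite (le_lt_trans (ler_norm _))// ltrDl.
exists (clamp x); first exact: clamp_itv.
by rewrite (clamp_id (clamp_itv _)).
Qed.

Lemma clamp_fun2_ln_bounded (f : R * R -> R) :
  {within `[0, 1] `*` `[0, 1], continuous f} ->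
  (forall x y, x \in `[0, 1] -> y \in `[0, 1] -> 0 < f (x, y)) ->
  exists2 M, 0 <= M & forall x y, `|ln (f (clamp x, clamp y))| <= M.
Proof.
move=> cf f0.
have cl : continuous (fun u : R * R => ln (f (clamp u.1, clamp u.2))).
  move=> u; apply: continuous_comp; first exact: continuous_clamp_fun2 cf u.
  by apply: continuous_ln; rewrite f0// clamp_itv.
have comp : compact ((fun u : R * R => ln (f (clamp u.1, clamp u.2))) @`
    (`[0, 1] `*` `[0, 1])).
  apply: continuous_compact; last by apply: compact_setX; exact: segment_compact.
  exact: continuous_subspaceT.
have [M [_ HM]] := compact_bounded comp.
exists (`|M| + 1) => [|x y]; first by rewrite addr_ge0.
apply: HM; first by rewrite (le_lt_trans (ler_norm _))// ltrDl.
exists (clamp x, clamp y); first by split; exact: clamp_itv.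
by rewrite /= !(clamp_id (clamp_itv _)).
Qed.

End clamp.

(** * The reversed chain *)

Lemma density_law_indic (R : realType) (f F : R -> R) (B : set R) :
  (forall y, y \in `[0, 1] -> f y = F y) ->
  density_law f B =
  (\int[lebesgue_measure]_(y in B) (F y * \1_`[0%R, 1%R] y)%:E)%E.
Proof.
move=> fF; rewrite /density_law integral_mkcondl; apply: eq_integral => y _.
rewrite patchE indicE; case: ifPn => y01; last by rewrite mulr0.
by rewrite mulr1 fF//; move: y01; rewrite inE.
Qed.

(** The entropy being linear in T, its quotient by T is constant for T > 0. *)
Lemma mean_rel_entropy_cvg (R : realType) (Q Q' : probability (pathT R) R) (c : R) :
  (forall T, 0 <= T -> rel_entropy Q Q' T = (- (T * c))%:E) ->
  mean_rel_entropy Q Q' T @[T --> +oo] --> (- c)%:E.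
Proof.
move=> QE; apply: cvg_near_cst; near=> T.
have T0 : 0 < T by near: T; exact: nbhs_pinfty_gt.
by rewrite /mean_rel_entropy QE ?ltW// -EFinM mulrN mulKf ?gt_eqF.
Unshelve. all: by end_near. Qed.

Section reversed_chain.
Context {R : realType}.
Variables (P : R -> R -> R) (theta : R -> R).
Hypothesis P_continuous : {within `[0, 1] `*` `[0, 1],
  continuous (fun z : R * R => P z.1 z.2)}.
Hypothesis P_gt0 : forall x y, x \in `[0, 1] -> y \in `[0, 1] -> 0 < P x y.
Hypothesis P_int1 : forall x, x \in `[0, 1] ->
  (\int[lebesgue_measure]_(y in `[0%R, 1%R]) (P x y)%:E = 1)%E.
Hypothesis theta_continuous : {within `[0, 1], continuous theta}.
Hypothesis theta_gt0 : forall x, x \in `[0, 1] -> 0 < theta x.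
Hypothesis theta_invariant : forall x, x \in `[0, 1] ->
  (\int[lebesgue_measure]_(y in `[0%R, 1%R]) (theta y * P y x)%:E
   = (theta x)%:E)%E.

(* Clamping keeps P and theta positive on the whole line, so that quotients need no
   side condition; the indicator I carries the restriction to [0, 1]. *)
Let p x y := P (clamp x) (clamp y).
Let th x := theta (clamp x).
Let I (x : R) : R := \1_`[0%R, 1%R] x.

Definition jump_density x y := p x y * I y.
Definition initial_density x := th x * I x.

(* The jump density of the reversed process over that of the process. *)
Definition reversal_ratio x y := (th y * p y x) / (th x * p x y).

Let p0 x y : 0 < p x y. Proof. by apply: P_gt0; exact: clamp_itv. Qed.
Let th0 x : 0 < th x. Proof. by apply: theta_gt0; exact: clamp_itv. Qed.
Let I0 x : 0 <= I x. Proof. by []. Qed.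
Let p_neq0 x y : p x y != 0. Proof. by rewrite gt_eqF. Qed.
Let th_neq0 x : th x != 0. Proof. by rewrite gt_eqF. Qed.

Let mp : measurable_fun setT (fun u : R * R => p u.1 u.2).
Proof. exact: measurable_clamp_fun2 P_continuous. Qed.

Let mp' : measurable_fun setT (fun u : R * R => p u.2 u.1).
Proof.
exact: (measurableT_comp mp (measurable_fun_pair measurable_snd measurable_fst)).
Qed.

Let mth : measurable_fun setT th.
Proof. by apply: continuous_measurable_fun; exact: continuous_clamp_fun. Qed.

Let mI : measurable_fun setT I. Proof. exact: measurable_indic. Qed.

Let m1 (f : R -> R) : measurable_fun setT f ->
  measurable_fun setT (fun u : R * R => f u.1).
Proof. by move=> mf; exact: (measurableT_comp mf measurable_fst). Qed.

Let m2 (f : R -> R) : measurable_fun setT f ->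
  measurable_fun setT (fun u : R * R => f u.2).
Proof. by move=> mf; exact: (measurableT_comp mf measurable_snd). Qed.

Lemma jump_density_ge0 x y : 0 <= jump_density x y.
Proof. by rewrite mulr_ge0// ltW. Qed.

Lemma initial_density_ge0 x : 0 <= initial_density x.
Proof. by rewrite mulr_ge0// ltW. Qed.

Lemma reversal_ratio_gt0 x y : 0 < reversal_ratio x y.
Proof. by rewrite divr_gt0// mulr_gt0. Qed.

Lemma reversal_ratio_diag x : reversal_ratio x x = 1.
Proof. by rewrite /reversal_ratio divff// mulf_neq0. Qed.

Lemma reversal_ratioV x y : reversal_ratio x y * reversal_ratio y x = 1.
Proof. by rewrite /reversal_ratio; field; rewrite !p_neq0 !th_neq0. Qed.

Lemma reversal_ratio_detailed x y :
  initial_density x * (jump_density x y * reversal_ratio x y) =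
  initial_density y * jump_density y x.
Proof.
rewrite /initial_density /jump_density /reversal_ratio; field.
by rewrite p_neq0 th_neq0.
Qed.

Lemma measurable_jump_density :
  measurable_fun setT (fun u : R * R => jump_density u.1 u.2).
Proof. by apply: measurable_funM => //; exact: m2. Qed.

Lemma measurable_initial_density : measurable_fun setT initial_density.
Proof. exact: measurable_funM. Qed.

Lemma measurable_reversal_ratio :
  measurable_fun setT (fun u : R * R => reversal_ratio u.1 u.2).
Proof.
(* The inverse of the positive denominator is written as exp(-ln), a composition of measurable
   functions. *)
rewrite (_ : (fun u => _) = fun u : R * R =>
  th u.2 * p u.2 u.1 * expR (- ln (th u.1 * p u.1 u.2))); last first.
  by apply/funext => u; rewrite expRN lnK// posrE mulr_gt0.
apply: measurable_funM; first by apply: measurable_funM => //; exact: m2.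
apply: measurableT_comp => //; apply: measurable_funN; apply: measurableT_comp => //.
by apply: measurable_funM => //; exact: m1.
Qed.

Lemma reversal_ratio_ln_bounded :
  exists2 M, 0 <= M & forall x y, `|ln (reversal_ratio x y)| <= M.
Proof.
have [M1 M10 HM1] := clamp_fun2_ln_bounded P_continuous P_gt0.
have [M2 M20 HM2] := clamp_fun_ln_bounded theta_continuous theta_gt0.
(* The logarithm of the ratio is a signed sum of two logarithms of P, each bounded by [M1], and two
   of theta, each bounded by [M2]. *)
exists (2 * (M1 + M2)) => [|x y]; first by rewrite mulr_ge0 ?addr_ge0.
have := HM1 x y; have := HM1 y x; have := HM2 x; have := HM2 y.
rewrite /reversal_ratio ln_div ?posrE ?mulr_gt0// !lnM ?posrE//.
rewrite /p /th /= !ler_norml.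
do 4 (move=> /andP[? ?]); apply/andP; split; lra.
Qed.

Lemma initial_lawE B :
  density_law theta B = (\int[lebesgue_measure]_(y in B) (initial_density y)%:E)%E.
Proof. by apply: density_law_indic => y y01; rewrite /th clamp_id. Qed.

Lemma jump_lawE x B : x \in `[0, 1] ->
  density_law (P x) B = (\int[lebesgue_measure]_(y in B) (jump_density x y)%:E)%E.
Proof. by move=> x01; apply: density_law_indic => y y01; rewrite /p !clamp_id. Qed.

Lemma reversed_lawE x B : x \in `[0, 1] ->
  density_law (reversed_density theta P x) B =
  (\int[lebesgue_measure]_(y in B) (jump_density x y * reversal_ratio x y)%:E)%E.
Proof.
move=> x01; rewrite (density_law_indic (F := fun y => p x y * reversal_ratio x y)).
  by apply: eq_integral => y _; congr (_%:E); rewrite /jump_density mulrAC.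
move=> y y01; rewrite /reversed_density /reversal_ratio.
rewrite -{1}(clamp_id x01) -{1}(clamp_id y01) -{2}(clamp_id x01) -{2}(clamp_id y01).
rewrite -/(th x) -/(th y) -/(p y x).
by field; rewrite p_neq0 th_neq0.
Qed.

Local Open Scope ereal_scope.

Let integral_indic01 (f : R -> R) :
  \int[lebesgue_measure]_x (f x * I x)%:E =
  \int[lebesgue_measure]_(x in `[0%R, 1%R]) (f x)%:E.
Proof.
rewrite [RHS]integral_mkcond; apply: eq_integral => x _.
by rewrite patchE /I indicE; case: ifPn => _; rewrite ?mulr1 ?mulr0.
Qed.

Let mjy y : measurable_fun setT (fun x => jump_density y x).
Proof. exact: (measurableT_comp measurable_jump_density (pair1_measurable y)). Qed.

Lemma jump_density_invariant y :
  \int[lebesgue_measure]_x (initial_density x * jump_density x y)%:E =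
  (initial_density y)%:E.
Proof.
have thinv : \int[lebesgue_measure]_x (th x * p x y * I x)%:E = (th y)%:E.
  rewrite integral_indic01 /th /p -(theta_invariant (clamp_itv y)).
  by apply: eq_integral => x; rewrite inE /= => x01; rewrite (clamp_id x01).
transitivity (\int[lebesgue_measure]_x ((th x * p x y * I x)%:E * (I y)%:E)).
  apply: eq_integral => x _; rewrite -EFinM; congr (_%:E).
  rewrite /initial_density /jump_density; ring.
rewrite ge0_integralZr ?thinv//.
- apply/measurable_EFinP; apply: measurable_funM => //; apply: measurable_funM => //.
  exact: (measurableT_comp mp (pair2_measurable y)).
- by move=> x _; rewrite lee_fin mulr_ge0// mulr_ge0// ltW.
- by rewrite lee_fin.
Qed.

(** The identity [reversal_ratio_detailed] turns the integral into theta(y) times the total mass of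
    P(y, .), so invariance for the reversed kernel is the normalization of the original one. *)
Lemma reversed_density_invariant y :
  \int[lebesgue_measure]_x
    (initial_density x * (jump_density x y * reversal_ratio x y))%:E =
  (initial_density y)%:E.
Proof.
under eq_integral do rewrite reversal_ratio_detailed EFinM.
have jump1 : \int[lebesgue_measure]_x (jump_density y x)%:E = 1.
  rewrite integral_indic01 -(P_int1 (clamp_itv y)) /p.
  by apply: eq_integral => x; rewrite inE /= => x01; rewrite (clamp_id x01).
rewrite ge0_integralZl ?lee_fin ?initial_density_ge0 ?jump1 ?mule1//.
- by move: (mjy y) => /measurable_EFinP.
- by move=> x _; rewrite lee_fin jump_density_ge0.
Qed.

(** On the left the reversed kernel is the reference, and multiplying by the transposed ratio
    cancels the ratio in it. The remaining integrand is the one on the right with its variables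
    exchanged, and Tonelli applies because the shift by M keeps it nonnegative. *)
Lemma log_ratio_mean_sym (M : R) :
  (forall x y, `|ln (reversal_ratio x y)| <= M)%R ->
  log_ratio_mean initial_density
    (fun x y => jump_density x y * reversal_ratio x y)%R
    (fun x y => reversal_ratio y x) M =
  log_ratio_mean initial_density jump_density reversal_ratio M.
Proof.
move=> HM.
have hM x y : (0 <= ln (reversal_ratio x y) + M)%R.
  by have := HM x y; rewrite ler_norml => /andP[]; rewrite -lerBlDr sub0r.
pose F (u : R * R) := (ln (reversal_ratio u.1 u.2) + M)%:E *
  (initial_density u.1 * (jump_density u.1 u.2 * reversal_ratio u.1 u.2))%:E.
have F0 u : 0 <= F u.
  rewrite mule_ge0// lee_fin ?hM//.
  apply: mulr_ge0; first exact: initial_density_ge0.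
  by apply: mulr_ge0; [exact: jump_density_ge0|exact/ltW/reversal_ratio_gt0].
have mF : measurable_fun setT F.
  apply: emeasurable_funM; apply/measurable_EFinP.
    apply: measurable_funD => //; apply: measurableT_comp => //.
    exact: measurable_reversal_ratio.
  apply: measurable_funM; first exact: (m1 measurable_initial_density).
  apply: measurable_funM; first exact: measurable_jump_density.
  exact: measurable_reversal_ratio.
rewrite /log_ratio_mean.
transitivity (\int[lebesgue_measure]_y \int[lebesgue_measure]_x F (x, y)).
  apply: eq_integral => y _; apply: eq_integral => x _.
  rewrite /F /= reversal_ratio_detailed -mulrA reversal_ratioV mulr1.
  by [].
by rewrite -(fubini_tonelli (m1 := lebesgue_measure) (m2 := lebesgue_measure) F).
Qed.

End reversed_chain.

Unset Implicit Arguments.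
Set Strict Implicit.

Theorem theorem2 (R : realType) (P : R -> R -> R) (theta : R -> R)
    (Pmu Phat : probability (pathT R) R)
    (P_continuous : {within `[0, 1] `*` `[0, 1],
                      continuous (fun z : R * R => P z.1 z.2)})
    (P_gt0 : forall x y, x \in `[0, 1] -> y \in `[0, 1] -> 0 < P x y)
    (P_int1 : forall x, x \in `[0, 1] ->
      (\int[lebesgue_measure]_(y in `[0%R, 1%R]) (P x y)%:E = 1)%E)
    (theta_continuous : {within `[0, 1], continuous theta})
    (theta_gt0 : forall x, x \in `[0, 1] -> 0 < theta x)
    (theta_int1 :
      (\int[lebesgue_measure]_(y in `[0%R, 1%R]) (theta y)%:E = 1)%E)
    (theta_invariant : forall x, x \in `[0, 1] ->
      (\int[lebesgue_measure]_(y in `[0%R, 1%R]) (theta y * P y x)%:E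
       = (theta x)%:E)%E)
    (Pmu_law : jump_process_law (density_law theta)
                 (fun x => density_law (P x)) Pmu)
    (Phat_law : jump_process_law (density_law theta)
                 (fun x => density_law (reversed_density theta P x)) Phat) :
  [/\ mutually_ac Pmu Phat,
      exists h : R, mean_rel_entropy Phat Pmu T @[T --> +oo] --> h%:E,
      exists h : R, mean_rel_entropy Pmu Phat T @[T --> +oo] --> h%:E
    & (- rel_entropy_rate Phat Pmu = - rel_entropy_rate Pmu Phat)%E].
Proof.
have [M M0 HM] :=
  reversal_ratio_ln_bounded P_continuous P_gt0 theta_continuous theta_gt0.
pose r := reversal_ratio P theta; pose k := jump_density P.
pose th := initial_density theta.
have mr : measurable_fun setT (fun u : R * R => r u.1 u.2).
  exact: measurable_reversal_ratio.
have mk : measurable_fun setT (fun u : R * R => k u.1 u.2).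
  exact: measurable_jump_density.
have mth : measurable_fun setT th by exact: measurable_initial_density.
have r0 x y : 0 < r x y by exact: reversal_ratio_gt0.
have k0 x y : 0 <= k x y by exact: jump_density_ge0.
have th0 x : 0 <= th x by exact: initial_density_ge0.
have r1 x : r x x = 1 by exact: reversal_ratio_diag.
(* Reversing twice restores the original jump density. *)
have krr x y : k x y * r x y * r y x = k x y.
  by rewrite -mulrA reversal_ratioV ?mulr1.
pose c := fine (log_ratio_mean th k r M) - M.
have Phat_entropy t : 0 <= t ->
    restr_upto Phat t `<< restr_upto Pmu t /\
    rel_entropy Phat Pmu t = (- (t * c))%:E.
  apply: (jump_process_rel_entropy Pmu_law Phat_law) => //.
  - by move=> B _; exact: initial_lawE.
  - by move=> x B x01 _; exact: jump_lawE.
  - by move=> x B x01 _; exact: reversed_lawE.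
  - by move=> y; exact: reversed_density_invariant.
have Pmu_entropy t : 0 <= t ->
    restr_upto Pmu t `<< restr_upto Phat t /\
    rel_entropy Pmu Phat t = (- (t * c))%:E.
  (* The constant is first rewritten as the mean with the two processes exchanged, the form produced
     by the second application of the entropy formula. *)
  rewrite /c -log_ratio_mean_sym//.
  apply: (jump_process_rel_entropy Phat_law Pmu_law) => //.
  - by move=> B _; exact: initial_lawE.
  - by move=> x B x01 _; exact: reversed_lawE.
  - move=> x B x01 _; rewrite jump_lawE//.
    by apply: eq_integral => y _; rewrite krr.
  - exact: measurable_funM.
  - by move=> x y; rewrite mulr_ge0// ltW.
  - exact: (measurableT_comp mr (measurable_fun_pair measurable_snd measurable_fst)).
  - move=> y; under eq_integral do rewrite krr.
    exact: jump_density_invariant.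
have Phat_rate : mean_rel_entropy Phat Pmu T @[T --> +oo] --> (- c)%:E.
  by apply: mean_rel_entropy_cvg => T T0; exact: (Phat_entropy T T0).2.
have Pmu_rate : mean_rel_entropy Pmu Phat T @[T --> +oo] --> (- c)%:E.
  by apply: mean_rel_entropy_cvg => T T0; exact: (Pmu_entropy T T0).2.
split.
- by move=> T T0; split; [exact: (Pmu_entropy T T0).1|exact: (Phat_entropy T T0).1].
- by exists (- c).
- by exists (- c).
- by rewrite /rel_entropy_rate (cvg_lim _ Phat_rate)// (cvg_lim _ Pmu_rate).
Qed.
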